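(* Let $k$ be a field, let $n,p\ge 1$, and let $A=k\langle x_1,\dots,x_n\rangle/(f_1,\dots,f_p)$ be a finitely generated $k$-algebra such that $f_1\in k[x_1]$ and, for every $i\ge 2$, $f_i$ belongs to the two-sided ideal $(x_2,\dots,x_n)$ of $k\langle x_1,\dots,x_n\rangle$. If the commutative $k$-algebra $B=k[x_1]/(f_1)$ is not smooth over $k$, then there is an infinite strictly increasing sequence of integers $m_1<m_2<\cdots$ such that $HH_{m_j}(A)\neq 0$ for all $j$.
   Context: All algebras are associative and unital over the field $k$ (of arbitrary characteristic). $k\langle x_1,\dots,x_n\rangle$ is the free associative algebra and $(f_1,\dots,f_p)$ is the two-sided ideal generated by $f_1,\dots,f_p$. The Hochschild homology of a $k$-algebra $A$ is $HH_m(A)=\mathrm{Tor}_m^{A^e}(A,A)$ for $m\ge 0$, where $A^e=A\otimes_k A^{op}$; equivalently it is the homology of the Hochschild complex of $A$. The algebra $A$ is not assumed to be finite dimensional. *)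

(* Defs.v *)
From HB Require Import structures.
From mathcomp Require Import all_boot all_algebra.
From mathcomp Require Import finmap boolp.
From mathcomp Require Import monalg zify.

Set Implicit Arguments.
Unset Strict Implicit.
Unset Printing Implicit Defensive.

Import GRing.Theory.

Local Open Scope ring_scope.
Local Open Scope quotient_scope.

(* The k-algebras of MathComp ([algType k]) are nontrivial rings, but a
   presented algebra such as k[x]/(g) may be zero.  Hence this variant: a
   possibly trivial ring with a ring morphism from k to its center. *)
HB.mixin Record isPzAlgebra (k : fieldType) A of GRing.PzRing A := {
  in_pzalg : {rmorphism k -> A};
  in_pzalgC : forall (c : k) (a : A), in_pzalg c * a = a * in_pzalg c
}.

#[short(type="pzAlgType")]
HB.structure Definition PzAlgebra (k : fieldType) :=
  {A of isPzAlgebra k A & GRing.PzRing A}.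

#[short(type="comPzAlgType")]
HB.structure Definition ComPzAlgebra (k : fieldType) :=
  {A of PzAlgebra k A & GRing.ComPzRing A}.

Definition is_alg_morphism (k : fieldType) (A B : pzAlgType k)
    (phi : {rmorphism A -> B}) : Prop :=
  forall c : k, phi (in_pzalg c) = in_pzalg c.

Section ScalarInstances.
Variable k : fieldType.

Fact poly_scalarC (c : k) (p : {poly k}) : c%:P * p = p * c%:P.
Proof. exact: mulrC. Qed.

HB.instance Definition _ := isPzAlgebra.Build k {poly k} poly_scalarC.

Fact malg_scalarC (M : monomType) (c : k) (u : {malg k[M]}) :
  c%:MP * u = u * c%:MP.
Proof.
rewrite !malgM_def fgmulUg fgmulgU; apply: eq_bigr => m _.
by rewrite mulrC mul1m mulm1.
Qed.

HB.instance Definition _ (M : monomType) :=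
  isPzAlgebra.Build k (malg M k) (@malg_scalarC M).

End ScalarInstances.

Notation free_alg k n := {malg k[{fmonom 'I_n}]}.

Definition fvar {k : fieldType} {n : nat} (i : 'I_n) : free_alg k n :=
  << fmu i >>.

Section Ideal.
Variables (R : pzRingType) (I : Type) (f : I -> R).

(* The two-sided ideal generated by the family f. *)
Definition ideal : {pred R} := fun u =>
  `[< exists s : seq (R * I * R), u = \sum_(t <- s) t.1.1 * f t.1.2 * t.2 >].

Lemma idealP u : reflect
  (exists s : seq (R * I * R), u = \sum_(t <- s) t.1.1 * f t.1.2 * t.2)
  (u \in ideal).
Proof. exact: asboolP. Qed.

Lemma ideal_zmod_closed : zmod_closed ideal.
Proof.
split=> [|u v /idealP[s ->] /idealP[t ->]].
  by apply/idealP; exists [::]; rewrite big_nil.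
apply/idealP; exists (s ++ [seq (- x.1.1, x.1.2, x.2) | x <- t]).
rewrite big_cat big_map -sumrN; congr (_ + _).
by apply: eq_bigr => x _; rewrite !mulNr.
Qed.

HB.instance Definition _ := GRing.isZmodClosed.Build R ideal ideal_zmod_closed.

Lemma ideal_mull u v : v \in ideal -> u * v \in ideal.
Proof.
move=> /idealP[s ->]; apply/idealP.
exists [seq (u * x.1.1, x.1.2, x.2) | x <- s].
by rewrite big_map mulr_sumr; apply: eq_bigr => x _; rewrite !mulrA.
Qed.

Lemma ideal_mulr u v : u \in ideal -> u * v \in ideal.
Proof.
move=> /idealP[s ->]; apply/idealP.
exists [seq (x.1.1, x.1.2, x.2 * v) | x <- s].
by rewrite big_map mulr_suml; apply: eq_bigr => x _; rewrite !mulrA.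
Qed.

Lemma ideal_gen i : f i \in ideal.
Proof.
by apply/idealP; exists [:: (1, i, 1)]; rewrite big_seq1 mul1r mulr1.
Qed.

Definition quot_alg : Type := {ideal_quot ideal}.
HB.instance Definition _ := GRing.Zmodule.on quot_alg.

Definition to_quot (u : R) : quot_alg := \pi_({ideal_quot ideal}) u.

Lemma to_quot_eq u v : (to_quot u = to_quot v) <-> (u - v \in ideal).
Proof. by rewrite Quotient.idealrBE; split=> /eqP. Qed.

Lemma to_quot_surj (x : quot_alg) : exists u, x = to_quot u.
Proof. by exists (repr (x : {ideal_quot ideal})); rewrite /to_quot reprK. Qed.

Fact to_quot_zmod_morphism : zmod_morphism to_quot.
Proof. by move=> u v; rewrite /to_quot raddfB. Qed.
HB.instance Definition _ :=
  GRing.isZmodMorphism.Build R quot_alg to_quot to_quot_zmod_morphism.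

Definition quot_mul (x y : quot_alg) : quot_alg :=
  to_quot (repr (x : {ideal_quot ideal}) * repr (y : {ideal_quot ideal})).

Lemma to_quotM u v : to_quot (u * v) = quot_mul (to_quot u) (to_quot v).
Proof.
have repr_to w : w - repr (to_quot w : {ideal_quot ideal}) \in ideal.
  by apply/to_quot_eq; rewrite [RHS]/to_quot reprK.
apply/to_quot_eq; set u' := repr (to_quot u : {ideal_quot ideal}).
set v' := repr _; have -> : u * v - u' * v' = (u - u') * v + u' * (v - v').
  by rewrite mulrBl mulrBr addrA subrK.
by apply: rpredD; [apply: ideal_mulr | apply: ideal_mull]; apply: repr_to.
Qed.

Fact quot_mulA : associative quot_mul.
Proof.
move=> x y z; case: (to_quot_surj x) (to_quot_surj y) (to_quot_surj z).
by move=> u -> [v ->] [w ->]; rewrite -!to_quotM mulrA.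
Qed.
Fact quot_mul1l : left_id (to_quot 1) quot_mul.
Proof.
by move=> x; case: (to_quot_surj x) => u ->; rewrite -to_quotM mul1r.
Qed.
Fact quot_mul1r : right_id (to_quot 1) quot_mul.
Proof.
by move=> x; case: (to_quot_surj x) => u ->; rewrite -to_quotM mulr1.
Qed.
Fact quot_mulDl : left_distributive quot_mul +%R.
Proof.
move=> x y z; case: (to_quot_surj x) (to_quot_surj y) (to_quot_surj z).
by move=> u -> [v ->] [w ->]; rewrite -raddfD -!to_quotM mulrDl raddfD.
Qed.
Fact quot_mulDr : right_distributive quot_mul +%R.
Proof.
move=> x y z; case: (to_quot_surj x) (to_quot_surj y) (to_quot_surj z).
by move=> u -> [v ->] [w ->]; rewrite -raddfD -!to_quotM mulrDr raddfD.
Qed.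
HB.instance Definition _ := GRing.Zmodule_isPzRing.Build quot_alg
  quot_mulA quot_mul1l quot_mul1r quot_mulDl quot_mulDr.

Fact to_quot_monoid_morphism : monoid_morphism to_quot.
Proof. by split=> // u v; rewrite to_quotM. Qed.
HB.instance Definition _ :=
  GRing.isMonoidMorphism.Build R quot_alg to_quot to_quot_monoid_morphism.

End Ideal.

Section QuotAlgebra.
Variables (k : fieldType) (A : pzAlgType k) (I : Type) (f : I -> A).

Definition quot_scalar : k -> quot_alg f := to_quot f \o in_pzalg.
HB.instance Definition _ := GRing.RMorphism.on quot_scalar.

Fact quot_scalarC (c : k) (x : quot_alg f) :
  quot_scalar c * x = x * quot_scalar c.
Proof.
case: (to_quot_surj x) => u ->.
by rewrite /quot_scalar /= -!rmorphM in_pzalgC.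
Qed.
HB.instance Definition _ := isPzAlgebra.Build k (quot_alg f) quot_scalarC.
End QuotAlgebra.

Section ComQuot.
Variables (R : comPzRingType) (I : Type) (f : I -> R).
Fact quot_mulC : commutative (@quot_mul R I f).
Proof. by move=> x y; rewrite /quot_mul mulrC. Qed.
HB.instance Definition _ :=
  GRing.PzRing_hasCommutativeMul.Build (quot_alg f) quot_mulC.
End ComQuot.

Section ComQuotAlgebra.
Variables (k : fieldType) (A : comPzAlgType k) (I : Type) (f : I -> A).
HB.instance Definition _ := GRing.ComPzRing.on (quot_alg f).
End ComQuotAlgebra.

Section Smooth.
Variables (k : fieldType) (B : comPzAlgType k).

Definition finitely_presented : Prop :=
  exists (m q : nat) (h : 'I_q -> {mpoly k[m]})
    (phi : {rmorphism {mpoly k[m]} -> B}),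
    [/\ is_alg_morphism phi, (forall b, exists u, phi u = b)
      & forall u, phi u = 0 <-> u \in ideal h].

(* Infinitesimal lifting: every morphism to the quotient D = C/N of a
   commutative k-algebra C by an ideal N with N^2 = 0 lifts to C. *)
Definition formally_smooth : Prop :=
  forall (C D : comPzAlgType k) (pi : {rmorphism C -> D})
    (phi : {rmorphism B -> D}),
    is_alg_morphism pi -> (forall d, exists c, pi c = d) ->
    (forall c c', pi c = 0 -> pi c' = 0 -> c * c' = 0) ->
    is_alg_morphism phi ->
    exists2 psi : {rmorphism B -> C}, is_alg_morphism psi &
      forall b, pi (psi b) = phi b.

Definition smooth : Prop := finitely_presented /\ formally_smooth.
End Smooth.

Section Span.
Variables (k : fieldType) (V : lmodType k) (P : V -> Prop).

Definition span_of : {pred V} := fun v =>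
  `[< exists2 s : seq (k * V), (forall cu, cu \in s -> P cu.2)
      & v = \sum_(cu <- s) cu.1 *: cu.2 >].

Lemma span_ofP v : reflect
  (exists2 s : seq (k * V), (forall cu, cu \in s -> P cu.2)
     & v = \sum_(cu <- s) cu.1 *: cu.2) (v \in span_of).
Proof. exact: asboolP. Qed.

Lemma span_of_submod_closed : subsemimod_closed span_of.
Proof.
apply: GRing.submod_closed_semi.
split=> [|c u v /span_ofP[s Ps ->] /span_ofP[t Pt ->]]; apply/span_ofP.
  by exists [::]; rewrite ?big_nil.
exists ([seq (c * x.1, x.2) | x <- s] ++ t).
  by move=> x; rewrite mem_cat => /orP[/mapP[y /Ps Py ->]|/Pt].
rewrite big_cat big_map scaler_sumr; congr (_ + _).
by apply: eq_bigr => x _; rewrite scalerA.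
Qed.
HB.instance Definition _ :=
  GRing.isSubmodClosed.Build k V span_of span_of_submod_closed.

Lemma span_of_gen u : P u -> u \in span_of.
Proof.
move=> Pu; apply/span_ofP; exists [:: (1, u)]; last by rewrite big_seq1 scale1r.
by move=> x; rewrite inE => /eqP ->.
Qed.

Lemma span_ofZ c u : u \in span_of -> c *: u \in span_of.
Proof. exact: rpredZ. Qed.

(* The quotient of V by the submodule spanned by P. *)
Definition quot_mod : Type := {ideal_quot span_of}.
HB.instance Definition _ := GRing.Zmodule.on quot_mod.

Definition to_quot_mod (u : V) : quot_mod := \pi_({ideal_quot span_of}) u.

Lemma to_quot_mod_eq u v : to_quot_mod u = to_quot_mod v <-> u - v \in span_of.
Proof. by rewrite Quotient.idealrBE; split=> /eqP. Qed.

Definition quot_mod_repr (x : quot_mod) : V := repr (x : {ideal_quot span_of}).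

Lemma quot_mod_reprK x : to_quot_mod (quot_mod_repr x) = x.
Proof. exact: reprK. Qed.

Definition quot_scale (c : k) (x : quot_mod) : quot_mod :=
  to_quot_mod (c *: quot_mod_repr x).

Fact to_quot_mod_zmod_morphism : zmod_morphism to_quot_mod.
Proof. by move=> u v; rewrite /to_quot_mod raddfB. Qed.
HB.instance Definition _ :=
  GRing.isZmodMorphism.Build V quot_mod to_quot_mod to_quot_mod_zmod_morphism.

Lemma to_quot_modZ c u : to_quot_mod (c *: u) = quot_scale c (to_quot_mod u).
Proof.
apply/to_quot_mod_eq; rewrite -scalerBr; apply: span_ofZ.
by apply/to_quot_mod_eq; rewrite quot_mod_reprK.
Qed.

Fact quot_scalerA c d x : quot_scale c (quot_scale d x) = quot_scale (c * d) x.
Proof. by rewrite -[x]quot_mod_reprK -!to_quot_modZ scalerA. Qed.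
Fact quot_scale1r : left_id 1 quot_scale.
Proof. by move=> x; rewrite -[x]quot_mod_reprK -!to_quot_modZ scale1r. Qed.
Fact quot_scalerDr : right_distributive quot_scale +%R.
Proof.
move=> c x y; rewrite -[x]quot_mod_reprK -[y]quot_mod_reprK.
by rewrite -(raddfD to_quot_mod) -!to_quot_modZ -(raddfD to_quot_mod) scalerDr.
Qed.
Fact quot_scalerDl x : {morph quot_scale^~ x : c d / c + d}.
Proof.
move=> c d; rewrite -[x]quot_mod_reprK -!to_quot_modZ -(raddfD to_quot_mod).
by rewrite scalerDl.
Qed.
HB.instance Definition _ := GRing.Zmodule_isLmodule.Build k quot_mod
  quot_scalerA quot_scale1r quot_scalerDr quot_scalerDl.

HB.instance Definition _ :=
  GRing.isScalable.Build k V quot_mod *:%R to_quot_mod to_quot_modZ.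
End Span.

Section LinearExtension.
Variables (k : fieldType) (K : choiceType) (V : lmodType k) (h : K -> V).

Definition lin_ext (v : {malg k[K]}) : V := \sum_(a <- msupp v) v@_a *: h a.

Lemma lin_extEw (d : {fset K}) v :
  (msupp v `<=` d)%fset -> lin_ext v = \sum_(a <- d) v@_a *: h a.
Proof.
move=> le; rewrite /lin_ext (big_fset_incl _ le) //= => a _ /mcoeff_outdom ->.
by rewrite scale0r.
Qed.

Fact lin_ext_linear : linear lin_ext.
Proof.
move=> c u v; pose d := (msupp (c *: u + v) `|` (msupp u `|` msupp v))%fset.
have sub_u : (msupp u `<=` d)%fset by rewrite /d fsetUCA fsubsetUl.
have sub_v : (msupp v `<=` d)%fset by rewrite /d fsetUA fsubsetUr.
rewrite (lin_extEw (fsubsetUl _ _ : _ `<=` d)%fset).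
rewrite (lin_extEw sub_u) (lin_extEw sub_v).
rewrite scaler_sumr -big_split; apply: eq_bigr => a _.
by rewrite mcoeffD mcoeffZ scalerDl scalerA.
Qed.
HB.instance Definition _ :=
  GRing.isLinear.Build k {malg k[K]} V *:%R lin_ext lin_ext_linear.

Lemma lin_ext1 a : lin_ext << a >> = h a.
Proof. by rewrite (lin_extEw msuppU_le) big_seq_fset1 mcoeffUU scale1r. Qed.
End LinearExtension.

Section Tensor.
Variables (k : fieldType) (A : pzAlgType k).

Definition upd n (a : {ffun 'I_n -> A}) (i : 'I_n) (x : A) : {ffun 'I_n -> A} :=
  [ffun j => if j == i then x else a j].

Definition multilinear_rel n (v : {malg k[{ffun 'I_n -> A}]}) : Prop :=
  exists a i c x y, v = << upd a i (in_pzalg c * x + y) >>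
                        - (c *: << upd a i x >> + << upd a i y >>).

(* The n-th tensor power of A over k, as the free module on n-tuples modulo
   the multilinearity relations. *)
Definition tpow n : Type := quot_mod (@multilinear_rel n).
HB.instance Definition _ n := GRing.Lmodule.on (tpow n).

Definition tens n (a : {ffun 'I_n -> A}) : tpow n :=
  to_quot_mod (@multilinear_rel n) << a >>.

Fact tens_multilinear n (a : {ffun 'I_n -> A}) i c x y :
  tens (upd a i (in_pzalg c * x + y)) =
  c *: tens (upd a i x) + tens (upd a i y).
Proof.
rewrite /tens -linearP; apply/to_quot_mod_eq/span_of_gen.
by exists a, i, c, x, y.
Qed.

Section Faces.
Variable m : nat.
Implicit Type a : {ffun 'I_m.+2 -> A}.

Let lo (j : 'I_m.+1) : 'I_m.+2 := widen_ord (leqnSn _) j.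
Let hi (j : 'I_m.+1) : 'I_m.+2 := lift ord0 j.

(* (a_0, ..., a_(m+1)) |-> (a_0, ..., a_i a_(i+1), ..., a_(m+1)) *)
Definition face (i : 'I_m.+1) a : {ffun 'I_m.+1 -> A} :=
  [ffun j : 'I_m.+1 => if (j < i)%N then a (lo j)
             else if j == i then a (lo j) * a (hi j) else a (hi j)].

(* (a_0, ..., a_(m+1)) |-> (a_(m+1) a_0, a_1, ..., a_m) *)
Definition last_face a : {ffun 'I_m.+1 -> A} :=
  [ffun j => if j == ord0 then a ord_max * a ord0 else a (lo j)].

Definition hoch_pure a : tpow m.+1 :=
  \sum_(i < m.+1) (-1) ^+ i *: tens (face i a)
  + (-1) ^+ m.+1 *: tens (last_face a).

Lemma face_upd i a l : exists j h,
  (forall c x y, h (in_pzalg c * x + y) = in_pzalg c * h x + h y :> A) /\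
  forall x, face i (upd a l x) = upd (face i a) j (h x).
Proof.
have hl := ltn_ord l; have hlt := ltn_ord i.
case: (ltngtP l i) => [lt_li|lt_il|eq_li].
- exists (Ordinal (ltn_trans lt_li hlt)), id; split=> // x.
  apply/ffunP => j; rewrite !ffunE -!val_eqE /= /bump /=.
  by do !case: ifPn => //; lia.
- have [eq_l|ne_l] := eqVneq (l : nat) i.+1.
    exists i, (fun x => a (lo i) * x); split=> [c x y|x].
      by rewrite mulrDr mulrA -in_pzalgC mulrA.
    apply/ffunP => j; rewrite !ffunE -!val_eqE /= /bump /=.
    do !case: ifPn => //; (try lia) => *; congr (a _ * _); apply/val_inj.
    by rewrite /=; lia.
  have lt_l : (l.-1 < m.+1)%N by lia.
  exists (Ordinal lt_l), id; split=> // x.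
  apply/ffunP => j; rewrite !ffunE -!val_eqE /= /bump /=.
  by do !case: ifPn => //; lia.
- exists i, (fun x => x * a (hi i)); split=> [c x y|x].
    by rewrite mulrDl mulrA.
  apply/ffunP => j; rewrite !ffunE -!val_eqE /= /bump /=.
  do !case: ifPn => //; (try lia) => *; congr (_ * a _); apply/val_inj.
  by rewrite /= /bump; lia.
Qed.

Lemma last_face_upd a l : exists j h,
  (forall c x y, h (in_pzalg c * x + y) = in_pzalg c * h x + h y :> A) /\
  forall x, last_face (upd a l x) = upd (last_face a) j (h x).
Proof.
have hl := ltn_ord l.
have [eq_l|ne_l] := eqVneq l ord_max.
  exists ord0, (fun x => x * a ord0); split=> [c x y|x].
    by rewrite mulrDl mulrA.
  apply/ffunP => j; rewrite !ffunE eq_l eqxx -!val_eqE /=.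
  have hj := ltn_ord j; do !case: ifPn => //; lia.
have [eq_l|ne_l0] := eqVneq l ord0.
  exists ord0, (fun x => a ord_max * x); split=> [c x y|x].
    by rewrite mulrDr mulrA -in_pzalgC mulrA.
  apply/ffunP => j; rewrite !ffunE eq_l eqxx -!val_eqE /=.
  by do !case: ifPn => //; lia.
have lt_l : (l < m.+1)%N by rewrite -val_eqE /= in ne_l; lia.
exists (Ordinal lt_l), id; split=> // x.
rewrite -!val_eqE /= in ne_l ne_l0.
apply/ffunP => j; rewrite !ffunE -!val_eqE /=.
by do !case: ifPn => //; lia.
Qed.

Lemma hoch_pure_multilinear a l c x y :
  hoch_pure (upd a l (in_pzalg c * x + y)) =
  c *: hoch_pure (upd a l x) + hoch_pure (upd a l y).
Proof.
rewrite /hoch_pure scalerDr scaler_sumr addrACA -big_split /=; congr (_ + _).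
  apply: eq_bigr => i _; have [j [h [h_lin hE]]] := face_upd i a l.
  by rewrite !hE h_lin tens_multilinear scalerDr !scalerA mulrC.
have [j [h [h_lin hE]]] := last_face_upd a l.
by rewrite !hE h_lin tens_multilinear scalerDr !scalerA mulrC.
Qed.

Definition hoch_bd (t : tpow m.+2) : tpow m.+1 :=
  lin_ext hoch_pure (quot_mod_repr t).

Lemma hoch_bd_pi v :
  hoch_bd (to_quot_mod _ v) = lin_ext hoch_pure v.
Proof.
have /span_ofP[s rel_s eq_s] :
    v - quot_mod_repr (to_quot_mod (@multilinear_rel m.+2) v)
      \in span_of (@multilinear_rel m.+2).
  by apply/to_quot_mod_eq; rewrite quot_mod_reprK.
apply/eqP; rewrite eq_sym -subr_eq0 /hoch_bd -linearB eq_s linear_sum big_seq.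
apply/eqP/big1 => cu /rel_s[a [i [c [x [y ->]]]]].
rewrite linearZ linearB linearP /= !lin_ext1 hoch_pure_multilinear.
by rewrite subrr scaler0.
Qed.

Lemma hoch_bd_tens a : hoch_bd (tens a) = hoch_pure a.
Proof. by rewrite hoch_bd_pi lin_ext1. Qed.

Fact hoch_bd_linear : linear hoch_bd.
Proof.
move=> c t u; rewrite -[t]quot_mod_reprK -[u]quot_mod_reprK.
by rewrite -linearP !hoch_bd_pi linearP.
Qed.
HB.instance Definition _ :=
  GRing.isLinear.Build k (tpow m.+2) (tpow m.+1) *:%R hoch_bd hoch_bd_linear.

End Faces.

(* The Hochschild chains of degree m are [tpow m.+1]; every chain of degree 0
   is a cycle. *)
Definition hoch_cycle m : {pred tpow m.+1} :=
  match m return {pred tpow m.+1} with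
  | 0 => predT
  | m'.+1 => fun t => hoch_bd t == 0
  end.

Lemma hoch_cycleS m t : (t \in @hoch_cycle m.+1) = (hoch_bd t == 0).
Proof. by []. Qed.

Fact hoch_cycle_closed m : subsemimod_closed (@hoch_cycle m).
Proof.
apply: GRing.submod_closed_semi; case: m => [|m]; first by split.
split=> [|c u v]; first by rewrite hoch_cycleS (linear0 (@hoch_bd m)).
rewrite !hoch_cycleS => /eqP u0 /eqP v0.
by rewrite hoch_bd_linear u0 v0 scaler0 addr0.
Qed.
HB.instance Definition _ m :=
  GRing.isSubmodClosed.Build k (tpow m.+1) (@hoch_cycle m)
    (hoch_cycle_closed m).

Definition cycles m : Type := {t : tpow m.+1 | t \in @hoch_cycle m}.
HB.instance Definition _ m := SubChoice.on (cycles m).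
HB.instance Definition _ m := [SubChoice_isSubLmodule of cycles m by <:].

Definition is_boundary m (z : cycles m) : Prop :=
  exists w : tpow m.+2, hoch_bd w = \val z.

Definition HH m : Type := quot_mod (@is_boundary m).
HB.instance Definition _ m := GRing.Lmodule.on (HH m).

End Tensor.

Arguments HH {k} A m.

(* Main.v *)
From HB Require Import structures.
Require Import Defs.
From mathcomp Require Import all_boot all_algebra.
From mathcomp Require Import finmap boolp monalg zify ring.

Set Implicit Arguments.
Unset Strict Implicit.
Unset Printing Implicit Defensive.

(** Setting the variables x_2, ..., x_n to zero maps A onto B = k[x]/(g), because
    the relations other than the first lie in the ideal that these variables
    generate; the class of x_1 in A is a root of g, so it gives a section of this
    map. Hence the Hochschild homology of B is a direct summand of that of A.
    Instead of the functoriality of Hochschild homology, the proof uses the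
    retraction directly: cycles are built in A from the powers of X, the class of
    x_1, and they are detected by cocycles pulled back from B.

    If g is zero or prime to its derivative, then B is smooth: a root of g lifts
    along an extension with square zero kernel by one Newton step
    ([smooth_quot_poly]). So if B is not smooth, g is nonzero and
    d = gcd(g, g') is not constant. In that case the odd homology of B, which is
    B/(g'), is nonzero, and this is proved for A in every degree 2i+1
    ([HH_odd_neq0]).

    The cycle. The algebra B has a periodic resolution by free bimodules of rank
    one whose differentials are alternately X tensor 1 - 1 tensor X and the
    quotient of g(X) tensor 1 - 1 tensor g(X) by it. Its comparison map to the bar
    resolution is given by a recursion, applying the contracting homotopy to the
    differential of the preceding generator ([even_core], [odd_core],
    [bar_core]). Closing up the image of the generator of degree 2i+1 gives a
    Hochschild cycle, since the two ends of X tensor 1 - 1 tensor X are identified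
    ([hoch_bd_odd_cycle]).

    The cocycle. Products of remainders modulo g define the 2-cocycle
    [carry a b], the quotient by g of the product of the representatives of a and
    b; and d/dx is a derivation of B with values in k[x]/(d), since d divides both
    g and g'. The form a_0 d(a_1)/dx carry(a_2, a_3) ... carry(a_2i, a_(2i+1)) with
    values in k[x]/(d) vanishes on boundaries ([cochain_boundary]).

    The pairing. On the cycle the derivation contributes the derivative of x, and
    each [carry] contributes its value on the generator of degree 2, which is 1 by
    a telescoping sum ([carry_diff_quot]). So the form takes the value 1 modulo d
    on the cycle ([bar_cochain_core]), and 1 is not divisible by d. *)

Import GRing.Theory.

Local Open Scope ring_scope.

(** * Morphisms out of a quotient *)

Section QuotLift.
Variables (R S : pzRingType) (I : Type) (f : I -> R) (phi : {rmorphism R -> S}).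
Hypothesis phi_gen : forall i, phi (f i) = 0.

Lemma ideal_ker u : u \in ideal f -> phi u = 0.
Proof.
move=> /idealP[s ->]; rewrite rmorph_sum big1 // => t _.
by rewrite !rmorphM phi_gen mulr0 mul0r.
Qed.

Lemma quot_lift_subproof : exists2 psi : quot_alg f -> S,
  zmod_morphism psi /\ monoid_morphism psi & forall u, psi (to_quot f u) = phi u.
Proof.
pose psi (x : quot_alg f) : S := phi (projT1 (cid (to_quot_surj x))).
have psiE u : psi (to_quot f u) = phi u.
  rewrite /psi; case: cid => v /= /to_quot_eq/ideal_ker/eqP.
  by rewrite rmorphB subr_eq0 => /eqP.
exists psi => //; split; last split.
- move=> x y; have [u ->] := to_quot_surj x; have [v ->] := to_quot_surj y.
  by rewrite -rmorphB !psiE rmorphB.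
- by rewrite -(rmorph1 (to_quot f)) psiE rmorph1.
- move=> x y; have [u ->] := to_quot_surj x; have [v ->] := to_quot_surj y.
  by rewrite -rmorphM !psiE rmorphM.
Qed.

Lemma quot_lift : exists psi : {rmorphism quot_alg f -> S},
  forall u, psi (to_quot f u) = phi u.
Proof.
case: quot_lift_subproof => psi [psiB psiM] psiE.
pose m1 := GRing.isZmodMorphism.Build _ _ psi psiB.
pose m2 := GRing.isMonoidMorphism.Build _ _ psi psiM.
pose psi' : {rmorphism quot_alg f -> S} := HB.pack psi m1 m2.
by exists psi'.
Qed.
End QuotLift.

Lemma ideal_morph (R S : pzRingType) (I : Type) (f : I -> R)
    (phi : {rmorphism R -> S}) u :
  u \in ideal f -> phi u \in ideal (fun i => phi (f i)).
Proof.
move=> /idealP[s ->]; rewrite rmorph_sum rpred_sum // => t _.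
rewrite !rmorphM; apply/ideal_mulr/ideal_mull.
exact: (ideal_gen (fun i => phi (f i))).
Qed.

(** * Evaluation of polynomials in a possibly trivial algebra *)

Lemma malgUM (R : nzRingType) (M : monomType) (c d : R) (a b : M) :
  << c *g a >> * << d *g b >> = << c * d *g mmul a b >> :> {malg R[M]}.
Proof. by rewrite malgM_def fgmulUU. Qed.

Section PolyEvaluation.
Variables (k : fieldType) (A : pzAlgType k) (c : A).
Implicit Types p q : {poly k}.

(** The codomain may be the zero ring, which is not the target of an evaluation
    morphism of [{poly k}] defined for nontrivial rings. *)
Definition peval p : A := \sum_(i < size p) in_pzalg p`_i * c ^+ i.

Lemma peval_wide n p : (size p <= n)%N ->
  peval p = \sum_(i < n) in_pzalg p`_i * c ^+ i.
Proof.
move=> le_pn; rewrite /peval (big_ord_widen n (fun i => in_pzalg p`_i * c ^+ i)) //.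
rewrite big_mkcond; apply: eq_bigr => i _; case: ltnP => // /(nth_default 0) ->.
by rewrite rmorph0 mul0r.
Qed.

Fact peval_zmod_morphism : zmod_morphism peval.
Proof.
move=> p q; pose n := maxn (size p) (size q).
have le_n : (size (p - q)%R <= n)%N.
  by rewrite (leq_trans (size_polyD _ _)) // size_polyN.
rewrite (peval_wide le_n) (peval_wide (leq_maxl _ _ : (_ <= n)%N)).
rewrite (peval_wide (leq_maxr _ _ : (_ <= n)%N)) -sumrB; apply: eq_bigr => i _.
by rewrite coefB rmorphB mulrBl.
Qed.
HB.instance Definition _ :=
  GRing.isZmodMorphism.Build {poly k} A peval peval_zmod_morphism.

Lemma pevalC a : peval a%:P = in_pzalg a.
Proof.
by rewrite (peval_wide (size_polyC_leq1 a)) big_ord1 coefC eqxx mulr1.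
Qed.

Lemma peval_mulX p : peval (p * 'X) = peval p * c.
Proof.
have le_n : (size (p * 'X)%R <= (size p).+1)%N.
  by rewrite (leq_trans (size_polyMleq _ _)) // size_polyX addn2.
rewrite (peval_wide le_n) big_ord_recl coefMX eqxx rmorph0 mul0r add0r mulr_suml.
by apply: eq_bigr => i _; rewrite coefMX /= -mulrA -exprSr.
Qed.

Lemma pevalX : peval 'X = c.
Proof. by rewrite -['X]mul1r peval_mulX pevalC rmorph1 mul1r. Qed.

Lemma pevalZ a p : peval (a *: p) = in_pzalg a * peval p.
Proof.
rewrite (peval_wide (size_scale_leq a p)) mulr_sumr; apply: eq_bigr => i _.
by rewrite coefZ rmorphM mulrA.
Qed.

Fact peval_monoid_morphism : monoid_morphism peval.
Proof.
split=> [|p]; first by rewrite pevalC rmorph1.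
elim/poly_ind => [|q a IHq]; first by rewrite mulr0 !raddf0 mulr0.
rewrite mulrDr !raddfD /= mulrA !peval_mulX IHq mulrDr mulrA pevalC.
by rewrite mulrC mul_polyC pevalZ in_pzalgC.
Qed.
HB.instance Definition _ :=
  GRing.isMonoidMorphism.Build {poly k} A peval peval_monoid_morphism.

Lemma pevalXn i : peval 'X^i = c ^+ i.
Proof. by rewrite rmorphXn /= pevalX. Qed.

End PolyEvaluation.

Lemma alg_morphism_peval (k : fieldType) (A B : pzAlgType k)
    (phi : {rmorphism A -> B}) (c : A) (p : {poly k}) :
  is_alg_morphism phi -> phi (peval c p) = peval (phi c) p.
Proof.
move=> phi_alg; rewrite rmorph_sum; apply: eq_bigr => i _.
by rewrite rmorphM phi_alg rmorphXn.
Qed.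

Lemma peval_polyX (k : fieldType) (p : {poly k}) : peval 'X p = p.
Proof.
elim/poly_ind: p => [|p a IHp]; first exact: raddf0.
by rewrite rmorphD /= peval_mulX pevalC IHp.
Qed.

(** First order Taylor expansion: the higher terms are multiples of [n ^+ 2]. *)
Lemma peval_taylor (k : fieldType) (C : comPzAlgType k) (c n : C) (p : {poly k}) :
  n * n = 0 -> peval (c + n) p = peval c p + n * peval c p^`().
Proof.
move=> nn0; elim/poly_ind: p => [|p a IHp].
  by rewrite deriv0 !raddf0 mulr0 addr0.
rewrite derivD derivM derivX mulr1 derivC addr0 !rmorphD /= !peval_mulX !pevalC IHp.
set P := peval c p; set P' := peval c _.
have -> : (P + n * P') * (c + n) = P * c + n * (P' * c + P).
  rewrite mulrDr !mulrDl -[n * P' * n]mulrA [P' * n]mulrC [n * (n * _)]mulrA nn0.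
  by rewrite mul0r addr0 mulrDr mulrA -addrA [P * n]mulrC.
by rewrite addrAC.
Qed.

(** * Smoothness of k[x]/(g) for g zero or separable *)

Section OneVariable.
Variables (k : fieldType) (I : choiceType) (i0 : I).
Hypothesis I1 : forall i, i = i0.

(** Stated for any index type with one element rather than for the ordinals below
    1: the type of the indices then stays a variable during conversion. *)
Definition cmonom_Xn (m : {cmonom I}) : {poly k} := 'X ^+ (m i0).

Fact cmonom_Xn_mmorphism : mmorphism cmonom_Xn.
Proof. by split=> [m1 m2|]; rewrite /cmonom_Xn ?cmM ?exprD // cm1. Qed.
HB.instance Definition _ :=
  monalg.isMultiplicative.Build _ _ cmonom_Xn cmonom_Xn_mmorphism.

Definition mpoly1_poly : {malg k[{cmonom I}]} -> {poly k} :=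
  mmap (@polyC k) cmonom_Xn.
HB.instance Definition _ := GRing.RMorphism.on mpoly1_poly.

Definition mpoly1_X : {malg k[{cmonom I}]} := << ucm i0 >>.

Lemma mpoly1_monomE (m : {cmonom I}) : mpoly1_X ^+ (m i0) = << m >>.
Proof.
have pow n : exists2 l : {cmonom I}, mpoly1_X ^+ n = << l >> & l i0 = n.
  elim: n => [|n [l El l0]]; first by exists mone => //; rewrite cm1.
  exists (mmul (ucm i0) l); last by rewrite cmM l0 cmUU.
  rewrite exprS El malgUM mulr1; reflexivity.
have [l -> lm] := pow (m i0); congr << _ >>.
by apply/eqP/cmP => i; rewrite (I1 i).
Qed.

Lemma mpoly1_poly_alg : is_alg_morphism mpoly1_poly.
Proof. by move=> c; rewrite /= /mpoly1_poly mmapC. Qed.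

Lemma mpoly1_polyU c m : mpoly1_poly << c *g m >> = c *: 'X^(m i0).
Proof. by rewrite [LHS]mmapU mul_polyC. Qed.

Lemma mpoly1_polyK u : peval mpoly1_X (mpoly1_poly u) = u.
Proof.
rewrite {1}[u]monalgE (rmorph_sum mpoly1_poly) rmorph_sum [RHS]monalgE.
apply: eq_bigr => m _; rewrite /= mpoly1_polyU pevalZ pevalXn.
by rewrite mpoly1_monomE malgUM mul1m mulr1.
Qed.

Lemma poly_mpoly1K p : mpoly1_poly (peval mpoly1_X p) = p.
Proof.
rewrite (alg_morphism_peval _ _ mpoly1_poly_alg).
by rewrite /= mpoly1_polyU scale1r cmUU peval_polyX.
Qed.

End OneVariable.

Section Smoothness.
Variables (k : fieldType) (g : {poly k}).
Local Notation B := (quot_alg (fun _ : 'I_1 => g)).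
Local Notation x := (to_quot (fun _ : 'I_1 => g) 'X).

Lemma quot_poly_gen0 : to_quot (fun _ : 'I_1 => g) g = 0.
Proof.
rewrite -(raddf0 (to_quot _)); apply/to_quot_eq; rewrite subr0.
exact: (@ideal_gen _ _ (fun _ : 'I_1 => g) ord0).
Qed.

Lemma quot_poly_finitely_presented : finitely_presented B.
Proof.
pose X0 := @mpoly1_X k 'I_1 ord0; pose ev := @mpoly1_poly k 'I_1 ord0.
exists 1%N, 1%N, (fun _ => peval X0 g).
exists (to_quot (fun _ : 'I_1 => g) \o ev); split.
- by move=> c; rewrite /= mpoly1_poly_alg.
- move=> b; have [p ->] := to_quot_surj b; exists (peval X0 p).
  by rewrite /= poly_mpoly1K.
- move=> u; split=> [/= u0|].
    rewrite -[u](mpoly1_polyK (@ord1)); apply: (@ideal_morph _ _ _ (fun=> g)).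
    by rewrite -[mpoly1_poly _ u]subr0; apply/to_quot_eq; rewrite u0 raddf0.
  by apply: ideal_ker => _ /=; rewrite poly_mpoly1K quot_poly_gen0.
Qed.

Lemma quot_polyE (C : pzAlgType k) (psi : {rmorphism B -> C}) p :
  is_alg_morphism psi -> psi (to_quot _ p) = peval (psi x) p.
Proof.
by move=> psi_alg; rewrite -alg_morphism_peval // -{1}(peval_polyX p)
  -alg_morphism_peval.
Qed.

(** A morphism out of k[x]/(g) is a root of g, so lifting a morphism amounts to
    lifting a root. *)
Lemma quot_poly_lift (C D : comPzAlgType k) (pi : {rmorphism C -> D})
    (phi : {rmorphism B -> D}) (c : C) :
  is_alg_morphism pi -> is_alg_morphism phi -> pi c = phi x -> peval c g = 0 ->
  exists2 psi : {rmorphism B -> C}, is_alg_morphism psi &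
    forall b, pi (psi b) = phi b.
Proof.
move=> pi_alg phi_alg pic gc0.
have [psi psiE] := quot_lift (fun _ : 'I_1 => gc0); exists psi.
  by move=> a; rewrite [in_pzalg a]/(to_quot _ a%:P) psiE /= pevalC.
move=> b; have [p ->] := to_quot_surj b.
by rewrite [RHS]quot_polyE // psiE /= alg_morphism_peval // pic.
Qed.

(** Any lift c of the given root satisfies g(c)^2 = 0, and one Newton step
    corrects it: if u g + v g' = 1, then c - v(c) g(c) is a root of g, because
    g(c) - g'(c) v(c) g(c) = u(c) g(c)^2. *)
Lemma smooth_quot_poly : g = 0 \/ coprimep g g^`() -> smooth B.
Proof.
move=> g_sep; split; [exact: quot_poly_finitely_presented|].
move=> C D pi phi pi_alg pi_surj N2 phi_alg; have [c pic] := pi_surj (phi x).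
suff [n pin gcn] : exists2 n, pi n = 0 & peval (c + n) g = 0.
  by apply: (quot_poly_lift (c := c + n)); rewrite // rmorphD pin addr0.
case: g_sep => [->|/Bezout_eq1_coprimepP[[u v] /= uv1]].
  by exists 0; rewrite raddf0.
have pig : pi (peval c g) = 0.
  rewrite alg_morphism_peval // pic -quot_polyE //.
  by rewrite quot_poly_gen0 raddf0.
exists (- (peval c v * peval c g));
  first by rewrite rmorphN rmorphM pig mulr0 oppr0.
set w := peval c v; set w' := peval c g.
have w'2 : w' * w' = 0 by apply: N2.
rewrite peval_taylor; last by rewrite mulrNN mulrACA w'2 mulr0.
have : w' * peval c (u * g + v * g^`()) = w' by rewrite uv1 rmorph1 mulr1.
rewrite rmorphD !rmorphM /= -/w -/w' mulrDr mulrCA w'2 mulr0 add0r.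
by rewrite -/w' mulrA [w' * w]mulrC mulNr => ->; rewrite subrr.
Qed.
End Smoothness.

(** * Free modules on a set of words *)

Section FreeModule.
Variables (k : fieldType) (K : choiceType).

Definition free_mod : lmodType k := {malg k[K]}.
Definition gen (a : K) : free_mod := << a >>.

Lemma free_ind (P : free_mod -> Prop) :
  P 0 -> (forall c a v, P v -> P (c *: gen a + v)) -> forall v, P v.
Proof.
move=> P0 PD v; rewrite [v]monalgE; elim: {1}(enum_fset _) => [|a s IHs].
  by rewrite big_nil.
rewrite big_cons; have -> : << v@_a *g a >> = v@_a *: << a >>; last exact: PD.
by apply/malgP => b; rewrite mcoeffZ !mcoeffU mulr_natr.
Qed.

Variable V : lmodType k.

(** Kept opaque so that rewriting never unfolds linear extensions into sums. *)
Fact ext_subproof (h : K -> V) :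
  {F : {linear free_mod -> V} | forall a, F (gen a) = h a}.
Proof. by exists (lin_ext h) => a; apply: lin_ext1. Qed.

Definition ext (h : K -> V) : {linear free_mod -> V} := sval (ext_subproof h).

Lemma ext_gen h a : ext h (gen a) = h a.
Proof. exact: (svalP (ext_subproof h)). Qed.

Lemma eq_linear_gen (F G : {linear free_mod -> V}) :
  (forall a, F (gen a) = G (gen a)) -> F =1 G.
Proof.
by move=> eqFG; elim/free_ind => [|c a v IHv]; rewrite ?linear0 ?linearP ?eqFG ?IHv.
Qed.

End FreeModule.

(** Two composites of linear maps agree once they agree on generators; this is
    how all the identities between operators on words are checked. *)
Lemma eq_comp_gen (k : fieldType) (K : choiceType) (U U' V : lmodType k)
    (F : {linear U -> V}) (G : {linear free_mod k K -> U})
    (F' : {linear U' -> V}) (G' : {linear free_mod k K -> U'}) :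
  (forall a, F (G (gen k a)) = F' (G' (gen k a))) -> forall v, F (G v) = F' (G' v).
Proof.
by move=> eqFG; apply: (@eq_linear_gen _ _ _ (F \o G) (F' \o G')).
Qed.

Lemma ext_comp (k : fieldType) (K : choiceType) (U V : lmodType k) (h : K -> U)
    (F : {linear U -> V}) v :
  F (ext h v) = ext (F \o h) v.
Proof. by elim/free_ind: v => [|c a v IHv];
  rewrite ?linear0 ?linearP ?IHv ?ext_gen. Qed.

(** * Words, faces and the bar differential *)

Section Words.
Variables (k : fieldType) (A : pzAlgType k).
(** A chain of degree n is a combination of words a of which only the entries
    a 0, ..., a n matter; infinite words avoid all transports between tensor
    powers of different lengths. *)
Definition word : choiceType := nat -> A.
Local Notation W := (free_mod k word).
Implicit Types (a : word) (u v : W).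

Definition word_upd a l x : word := fun j => if j == l then x else a j.
Definition face_word t a : word := fun j =>
  if (j < t)%N then a j else if j == t then a j * a j.+1 else a j.+1.
(** On chains this is the contracting homotopy of the bar complex. *)
Definition cons1 a : word := fun j => if j is j'.+1 then a j' else 1.
Definition mul_first x a : word := word_upd a 0 (x * a 0%N).
Definition mul_at n x a : word := word_upd a n (a n * x).
(** The passage from the bar resolution to Hochschild chains: the last factor of
    the bar chain is carried around to the front. *)
Definition close_word n a : word := word_upd a 0 (a n * a 0%N).

Definition wmap (f : word -> word) : {linear W -> W} := ext (fun a => gen k (f a)).

Definition bar n : {linear W -> W} :=
  ext (fun a => \sum_(t < n) (-1) ^+ t *: gen k (face_word t a)).

Lemma wmap_gen f a : wmap f (gen k a) = gen k (f a).
Proof. exact: ext_gen. Qed.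

Lemma ext_wmap (V : lmodType k) (h : word -> V) f u :
  ext h (wmap f u) = ext (h \o f) u.
Proof.
by elim/free_ind: u => [|c a u IHu];
  rewrite ?linear0 // !linearP IHu wmap_gen !ext_gen.
Qed.

Lemma face_word_lt t j a : (j < t)%N -> face_word t a j = a j.
Proof. by rewrite /face_word => ->. Qed.

Lemma face_word_eq t a : face_word t a t = a t * a t.+1.
Proof. by rewrite /face_word ltnn eqxx. Qed.

Lemma face_word_gt t j a : (t < j)%N -> face_word t a j = a j.+1.
Proof. by move=> lt_tj; rewrite /face_word ltnNge ltnW // gtn_eqF. Qed.

Lemma face_word0_cons1 a : face_word 0 (cons1 a) = a.
Proof. by apply/funext => -[|j]; rewrite /face_word //= mul1r. Qed.

Lemma face_wordS_cons1 t a : face_word t.+1 (cons1 a) = cons1 (face_word t a).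
Proof. by apply/funext => -[|j]. Qed.

Lemma face_word_mul_first t x a : face_word t (mul_first x a) =
  mul_first x (face_word t a).
Proof.
apply/funext => -[|j]; rewrite /face_word /mul_first /word_upd //=.
by case: t => [|t] //=; rewrite mulrA.
Qed.

Lemma face_word_mul_at n t x a : (t <= n)%N ->
  face_word t (mul_at n.+1 x a) = mul_at n x (face_word t a).
Proof.
move=> le_tn; apply/funext => j; rewrite /face_word /mul_at /word_upd eqSS.
case: (ltngtP j t) => [lt_jt|lt_tj|->]; case: (ltngtP n t) => ?; try lia;
  repeat (case: eqP => ?); subst; try lia; rewrite ?mulrA ?eqxx //.
Qed.

Lemma bar_gen n a : bar n (gen k a) =
  \sum_(t < n) (-1) ^+ t *: gen k (face_word t a).
Proof. exact: ext_gen. Qed.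

(** The homotopy identity b' s + s b' = id, which turns the construction of
    chains with a prescribed boundary into a recursion. *)
Lemma bar_cons1 n u : bar n.+1 (wmap cons1 u) = u - wmap cons1 (bar n u).
Proof.
apply/eqP; rewrite eq_sym subr_eq eq_sym; apply/eqP.
pose F : {linear W -> W} := (bar n.+1 \o wmap cons1) \+ (wmap cons1 \o bar n).
apply: (eq_linear_gen (F := F) (G := idfun)) u => a /=; rewrite wmap_gen !bar_gen.
rewrite big_ord_recl face_word0_cons1 expr0 scale1r -addrA (linear_sum (wmap _))
  -big_split /=.
rewrite big1 ?addr0 // => t _.
by rewrite face_wordS_cons1 linearZ wmap_gen exprS mulN1r scaleNr addNr.
Qed.

Lemma bar_mul_first n x u : bar n (wmap (mul_first x) u) =
  wmap (mul_first x) (bar n u).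
Proof.
apply: eq_comp_gen u => a; rewrite wmap_gen !bar_gen (linear_sum (wmap _)).
by apply: eq_bigr => t _;
  rewrite (linearZ_LR (wmap _)) wmap_gen face_word_mul_first.
Qed.

Lemma bar_mul_at n x u :
  bar n.+1 (wmap (mul_at n.+1 x) u) = wmap (mul_at n x) (bar n.+1 u).
Proof.
apply: eq_comp_gen u => a; rewrite wmap_gen !bar_gen (linear_sum (wmap _)).
by apply: eq_bigr => t _;
  rewrite (linearZ_LR (wmap _)) wmap_gen face_word_mul_at // -ltnS.
Qed.

Lemma mul_firstC_at n x y a : mul_first x (mul_at n y a) =
  mul_at n y (mul_first x a).
Proof.
apply/funext => j; rewrite /mul_first /mul_at /word_upd.
by case: n => [|n]; case: j => [|j] //=; rewrite mulrA.
Qed.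

Lemma mul_firstM x y a : mul_first x (mul_first y a) = mul_first (x * y) a.
Proof. by apply/funext => -[|j]; rewrite /mul_first /word_upd //= mulrA. Qed.

Lemma mul_atM n x y a : mul_at n x (mul_at n y a) = mul_at n (y * x) a.
Proof.
by apply/funext => j; rewrite /mul_at /word_upd; case: eqP => // _;
  rewrite eqxx mulrA.
Qed.

Lemma mul_first1 a : mul_first 1 a = a.
Proof. by apply/funext => -[|j]; rewrite /mul_first /word_upd //= mul1r. Qed.

Lemma mul_at1 n a : mul_at n 1 a = a.
Proof. by apply/funext => j; rewrite /mul_at /word_upd; case: eqP => [->|];
  rewrite ?mulr1. Qed.

(** * Combinations of words that vanish in the tensor powers *)

Section Multilinear.
Variables (V : lmodType k) (n : nat) (h : word -> V).

Definition multilinear : Prop := forall a l c x y, (l <= n)%N ->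
  h (word_upd a l (in_pzalg c * x + y)) =
    c *: h (word_upd a l x) + h (word_upd a l y).

Hypothesis h_lin : multilinear.

Lemma multilinear0 a l : (l <= n)%N -> h (word_upd a l 0) = 0.
Proof.
move=> le_ln; have := h_lin a (-1) 0 0 le_ln.
by rewrite mulr0 addr0 scaleN1r addNr.
Qed.

Lemma multilinear_sum a l r (c : nat -> k) (x : nat -> A) : (l <= n)%N ->
  h (word_upd a l (\sum_(i < r) in_pzalg (c i) * x i))
    = \sum_(i < r) c i *: h (word_upd a l (x i)).
Proof.
move=> le_ln; elim: r => [|r IHr]; first by rewrite !big_ord0 multilinear0.
by rewrite !big_ord_recr /= addrC h_lin // IHr addrC.
Qed.
End Multilinear.

Lemma mul_first_upd x a l y : mul_first x (word_upd a l y) =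
  if l == 0%N then word_upd (mul_first x a) l (x * y)
  else word_upd (mul_first x a) l y.
Proof.
by apply/funext; case: l => [|l] [|j]; rewrite /mul_first /word_upd.
Qed.

Lemma mul_at_upd n x a l y : mul_at n x (word_upd a l y) =
  if l == n then word_upd (mul_at n x a) l (y * x) else word_upd (mul_at n x a) l y.
Proof.
apply/funext => j; rewrite /mul_at /word_upd.
have [->|ne_ln] := eqVneq l n; have [eq_jn|ne_jn] := eqVneq j n;
  rewrite ?eq_jn ?eqxx //.
by rewrite eq_sym (negbTE ne_ln).
Qed.

Lemma cons1_upd a l y : cons1 (word_upd a l y) = word_upd (cons1 a) l.+1 y.
Proof. by apply/funext => -[|j]. Qed.

Lemma multilinear_mul_first (V : lmodType k) n (h : word -> V) x :
  multilinear n h -> multilinear n (h \o mul_first x).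
Proof.
move=> h_lin a l c y z le_ln /=; rewrite !mul_first_upd; case: eqP => _;
  rewrite -h_lin //.
by rewrite mulrDr !mulrA in_pzalgC.
Qed.

Lemma multilinear_mul_at (V : lmodType k) n m (h : word -> V) x :
  multilinear n h -> multilinear n (h \o mul_at m x).
Proof.
move=> h_lin a l c y z le_ln /=; rewrite !mul_at_upd; case: eqP => _;
  rewrite -h_lin //.
by rewrite mulrDl !mulrA.
Qed.

Lemma multilinear_cons1 (V : lmodType k) n (h : word -> V) :
  multilinear n.+1 h -> multilinear n (h \o cons1).
Proof. by move=> h_lin a l c y z le_ln /=; rewrite !cons1_upd h_lin. Qed.

(** The combinations killed by every multilinear function of the entries
    0, ..., n; they become zero in the tensor power. Testing against functions
    makes the stability under the word operations immediate. *)
Definition null n u : Prop :=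
  forall (V : lmodType k) (h : word -> V), multilinear n h -> ext h u = 0.

Lemma null0 n : null n 0.
Proof. by move=> V h _; rewrite linear0. Qed.

Lemma nullP n c u v : null n u -> null n v -> null n (c *: u + v).
Proof. by move=> u0 v0 V h h_lin; rewrite linearP u0 // v0 // scaler0 addr0. Qed.

Lemma nullB n u v : null n u -> null n v -> null n (u - v).
Proof. by move=> u0 v0 V h h_lin; rewrite linearB /= u0 // v0 // subrr. Qed.

Lemma null_mul_first n x u : null n u -> null n (wmap (mul_first x) u).
Proof.
by move=> u0 V h h_lin; rewrite ext_wmap u0 //; apply: multilinear_mul_first.
Qed.

Lemma null_mul_at n m x u : null n u -> null n (wmap (mul_at m x) u).
Proof.
by move=> u0 V h h_lin; rewrite ext_wmap u0 //; apply: multilinear_mul_at.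
Qed.

Lemma null_cons1 n u : null n u -> null n.+1 (wmap cons1 u).
Proof.
by move=> u0 V h h_lin; rewrite ext_wmap u0 //; apply: multilinear_cons1.
Qed.

End Words.

Arguments bar {k A} n.
Arguments cons1 {k A}.
Arguments mul_first {k A}.
Arguments mul_at {k A}.
Arguments close_word {k A}.
Arguments face_word {k A}.

(** * The two-periodic resolution inside the bar complex *)

Section Resolution.
Variables (k : fieldType) (A : pzAlgType k) (g : {poly k}) (X : A).
Local Notation word := (word A).
Local Notation W := (free_mod k word).
Implicit Types (a : word) (u v : W).

(** The multiplication by X tensor 1 - 1 tensor X, for the bimodule structure on
    the two end factors. *)
Definition comm n : {linear W -> W} :=
  ext (fun a => gen k (mul_first X a) - gen k (mul_at n X a)).

(** The multiplication by
    (g(X) tensor 1 - 1 tensor g(X)) / (X tensor 1 - 1 tensor X); together with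
    [comm] it gives the two alternating differentials of the periodic bimodule
    resolution of k[x]/(g). *)
Definition diff_quot n : {linear W -> W} :=
  ext (fun a => \sum_(i < size g) g`_i *:
    \sum_(j < i) gen k (mul_first (X ^+ j) (mul_at n (X ^+ (i.-1 - j)) a))).

(** The multiplication by g(X) tensor 1 - 1 tensor g(X). *)
Definition comm_g n : {linear W -> W} :=
  ext (fun a => \sum_(i < size g) g`_i *:
    (gen k (mul_first (X ^+ i) a) - gen k (mul_at n (X ^+ i) a))).

Lemma commE n u : comm n u = wmap (mul_first X) u - wmap (mul_at n X) u.
Proof.
elim/free_ind: u => [|c a u IHu]; first by rewrite !linear0 addr0.
rewrite linearP IHu ext_gen !(linearP (wmap _)) !wmap_gen.
by rewrite opprD addrACA -scalerBr.
Qed.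

Lemma diff_quotE n u : diff_quot n u = \sum_(i < size g) g`_i *:
  \sum_(j < i) wmap (mul_first (X ^+ j)) (wmap (mul_at n (X ^+ (i.-1 - j))) u).
Proof.
elim/free_ind: u => [|c a u IHu].
  by rewrite linear0 big1 // => i _; rewrite big1 ?scaler0 // => j _;
    rewrite !linear0.
rewrite linearP IHu ext_gen scaler_sumr -big_split; apply: eq_bigr => i _ /=.
rewrite scalerA mulrC -scalerA -scalerDr scaler_sumr -big_split.
by congr (_ *: _); apply: eq_bigr => j _; rewrite !linearP !wmap_gen.
Qed.

Lemma bar_comm n u : bar n.+1 (comm n.+1 u) = comm n (bar n.+1 u).
Proof. by rewrite !commE linearB /= bar_mul_first bar_mul_at. Qed.

Lemma bar_diff_quot n u : bar n.+1 (diff_quot n.+1 u) = diff_quot n (bar n.+1 u).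
Proof.
rewrite !diff_quotE (linear_sum (bar _)); apply: eq_bigr => i _.
rewrite (linearZ_LR (bar _)) (linear_sum (bar _)); congr (_ *: _).
by apply: eq_bigr => j _; rewrite bar_mul_first bar_mul_at.
Qed.

Lemma null_comm n m u : null n u -> null n (comm m u).
Proof.
by move=> u0; rewrite commE; apply: nullB;
  [apply: null_mul_first | apply: null_mul_at].
Qed.

Lemma null_diff_quot n m u : null n u -> null n (diff_quot m u).
Proof.
move=> u0; rewrite diff_quotE; elim/big_ind: _ => [|v w v0 w0|i _].
- exact: null0.
- by rewrite -[v]scale1r; apply: nullP.
rewrite -[_ *: _]addr0; apply: nullP; last exact: null0.
elim/big_ind: _ => [|v w v0 w0|j _]; first exact: null0.
  by rewrite -[v]scale1r; apply: nullP.
by apply/null_mul_first/null_mul_at.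
Qed.

Lemma telescope_powers n a i :
  \sum_(j < i) (gen k (mul_first (X ^+ j.+1) (mul_at n (X ^+ (i.-1 - j)) a))
                - gen k (mul_first (X ^+ j) (mul_at n (X ^+ (i - j)) a)))
  = gen k (mul_first (X ^+ i) a) - gen k (mul_at n (X ^+ i) a).
Proof.
pose P j := gen k (mul_first (X ^+ j) (mul_at n (X ^+ (i - j)) a)).
transitivity (\sum_(0 <= j < i) (P j.+1 - P j)).
  rewrite big_mkord; apply: eq_bigr => j _; rewrite /P.
  by have -> : (i.-1 - j = i - j.+1)%N by lia.
by rewrite telescope_sumr // /P subnn subn0 !expr0 mul_at1 mul_first1.
Qed.

Lemma comm_diff_quot n u : comm n (diff_quot n u) = comm_g n u.
Proof.
apply: (eq_comp_gen (F' := idfun)) u => a /=;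
  rewrite !ext_gen (linear_sum (comm n)).
apply: eq_bigr => i _; rewrite (linearZ_LR (comm n)) (linear_sum (comm n)).
rewrite -telescope_powers; congr (_ *: _); apply: eq_bigr => j _.
rewrite ext_gen mul_firstM -exprS -mul_firstC_at mul_atM -exprSr.
by have -> : (i.-1 - j).+1 = (i - j)%N by have := ltn_ord j; lia.
Qed.

Lemma diff_quot_comm n u : diff_quot n (comm n u) = comm_g n u.
Proof.
apply: (eq_comp_gen (F' := idfun)) u => a /=.
rewrite !ext_gen (linearB (diff_quot n)) /= !ext_gen -sumrB.
apply: eq_bigr => i _; rewrite -scalerBr -sumrB.
rewrite -telescope_powers; congr (_ *: _); apply: eq_bigr => j _.
rewrite -mul_firstC_at mul_firstM -exprSr mul_atM -exprS.
by have -> : (i.-1 - j).+1 = (i - j)%N by have := ltn_ord j; lia.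
Qed.

Hypothesis gX0 : peval X g = 0.

(** The only place where the equation g(X) = 0 is used. *)
Lemma null_comm_g n u : null n (comm_g n u).
Proof.
move=> V h h_lin; elim/free_ind: u => [|c a u IHu]; first by rewrite !linear0.
rewrite !linearP IHu addr0 ext_gen (linear_sum (ext h)).
rewrite (eq_bigr (fun i : 'I__ => g`_i *: h (word_upd a 0 (X ^+ i * a 0%N))
                       - g`_i *: h (word_upd a n (a n * X ^+ i)))); last first.
  by move=> i _; rewrite (linearZ_LR (ext h)) linearB /= !ext_gen scalerBr.
rewrite sumrB -(multilinear_sum h_lin a _ (fun i => g`_i) (fun i =>
  X ^+ i * a 0%N)) //.
rewrite -(multilinear_sum h_lin a _ (fun i => g`_i) (fun i => a n * X ^+ i)) //.
have -> : \sum_(i < size g) in_pzalg g`_i * (X ^+ i * a 0%N) = 0.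
  by under eq_bigr do rewrite mulrA; rewrite -mulr_suml -/(peval X g) gX0 mul0r.
have -> : \sum_(i < size g) in_pzalg g`_i * (a n * X ^+ i) = 0.
  under eq_bigr do rewrite mulrA in_pzalgC -mulrA.
  by rewrite -mulr_sumr -/(peval X g) gX0 mulr0.
by rewrite !(multilinear0 h_lin) // subrr scaler0.
Qed.

(** The comparison map from the periodic resolution to the bar resolution sends
    the generator of degree 2i to [cons1] of [even_core i] and the generator of
    degree 2i+1 to [cons1] of [odd_core i]: each chain is the homotopy applied to
    the periodic differential of the preceding one. The constant word 1 is the
    generator in degree 0 with its homotopy removed. *)
Fixpoint even_core i : W :=
  if i is i'.+1 then
    diff_quot i'.*2.+2 (wmap cons1 (comm i'.*2.+1 (wmap cons1 (even_core i'))))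
  else gen k (fun=> 1).
Definition odd_core i : W := comm i.*2.+1 (wmap cons1 (even_core i)).

(** Both correction terms of the homotopy identity vanish: they are homotopies of
    a composite of the two periodic differentials, up to what vanishes in lower
    degree, and that composite is the multiplication by
    g(X) tensor 1 - 1 tensor g(X). *)
Lemma bar_core i : null i.*2 (wmap cons1 (bar i.*2 (even_core i))) /\
  null i.*2 (bar i.*2.+1 (odd_core i)).
Proof.
have odd_of_even j : null j.*2 (comm j.*2 (even_core j)) ->
    null j.*2 (wmap cons1 (bar j.*2 (even_core j))) ->
    null j.*2 (bar j.*2.+1 (odd_core j)).
  move=> comm0 bar0; rewrite /odd_core bar_comm bar_cons1 linearB.
  by apply: nullB => //; apply: null_comm.
elim: i => [|i [even0 odd0]].
  have bar0 : null 0 (wmap cons1 (bar 0 (even_core 0))).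
    by rewrite ext_gen big_ord0 linear0; apply: null0.
  split=> //; apply: odd_of_even => //=; rewrite ext_gen.
  suff -> : mul_first X (fun=> 1) = mul_at 0 X (fun=> 1) by rewrite subrr;
    apply: null0.
  by apply/funext => -[|j]; rewrite /mul_first /mul_at /word_upd //= mulr1 mul1r.
have even1 : null i.+1.*2 (wmap cons1 (bar i.+1.*2 (even_core i.+1))).
  rewrite doubleS; apply: null_cons1;
    rewrite /= bar_diff_quot bar_cons1 -/(odd_core i).
  rewrite linearB; apply: nullB; last exact/null_diff_quot/null_cons1.
  by rewrite diff_quot_comm; apply: null_comm_g.
split=> //; apply: odd_of_even => //=; rewrite comm_diff_quot; apply: null_comm_g.
Qed.

End Resolution.

(** * From words to Hochschild chains *)

Section HochschildWords.
Variables (k : fieldType) (A : pzAlgType k).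
Local Notation word := (word A).
Local Notation W := (free_mod k word).
Implicit Types (a b : word) (u v : W).

Definition wtens m a : tpow A m.+1 := tens [ffun j : 'I_m.+1 => a j].

Lemma eq_wtens m a b : (forall j, (j <= m)%N -> a j = b j) -> wtens m a = wtens m b.
Proof.
move=> eq_ab; congr (tens _); apply/ffunP => j; rewrite !ffunE eq_ab //.
by rewrite -ltnS.
Qed.

Lemma upd_of_word m a l x : (l <= m)%N ->
  [ffun j : 'I_m.+1 => word_upd a l x j]
    = upd [ffun j : 'I_m.+1 => a j] (inord l) x :> {ffun 'I_m.+1 -> A}.
Proof.
by move=> le_lm; apply/ffunP => j; rewrite !ffunE /word_upd -val_eqE /= inordK.
Qed.

Lemma multilinear_wtens m : multilinear m (@wtens m).
Proof.
by move=> a l c x y le_lm; rewrite /wtens !upd_of_word // tens_multilinear.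
Qed.

Lemma wtens_inord m (b : {ffun 'I_m.+1 -> A}) :
  tens b = wtens m (fun j => b (inord j)).
Proof. by congr (tens _); apply/ffunP => j; rewrite ffunE inord_val. Qed.

Lemma hoch_bd_wtens m a : hoch_bd (wtens m.+1 a) =
  \sum_(t < m.+1) (-1) ^+ t *: wtens m (face_word t a)
  + (-1) ^+ m.+1 *: wtens m (close_word m.+1 a).
Proof.
have faceE (t : 'I_m.+1) : face t [ffun j : 'I_m.+2 => a j]
    = [ffun j : 'I_m.+1 => face_word t a j].
  by apply/ffunP => j; rewrite !ffunE /face_word -val_eqE.
have last_faceE : last_face [ffun j : 'I_m.+2 => a j]
    = [ffun j : 'I_m.+1 => close_word m.+1 a j].
  apply/ffunP => j; rewrite !ffunE /close_word /word_upd -val_eqE /=.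
  by case: eqP.
rewrite /wtens hoch_bd_tens /hoch_pure last_faceE.
by apply: (congr1 (fun s => s + _)); apply: eq_bigr => t _; rewrite faceE.
Qed.

(** The bar differential has no cyclic face, but one more ordinary face: the cyclic
    face of the closed word is the closure of the word in which the last two
    factors have been multiplied. *)
Lemma hoch_bd_close m u :
  hoch_bd (ext (wtens m.+1) (wmap (close_word m.+2) u))
    = ext (wtens m) (wmap (close_word m.+1) (bar m.+2 u)).
Proof.
pose F : {linear W -> tpow A m.+1} :=
  @hoch_bd k A m \o (ext (wtens m.+1) \o wmap (close_word m.+2)).
apply: (eq_comp_gen (F := idfun) (G := F) (F' := ext (wtens m) \o wmap _)) u
  => a /=.
rewrite wmap_gen ext_gen bar_gen (linear_sum (wmap _)) (linear_sum (ext _)).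
rewrite big_ord_recr /= hoch_bd_wtens.
congr (_ + _).
  apply: eq_bigr => t _; rewrite (linearZ_LR (wmap _)) (linearZ_LR (ext _)) /=.
  rewrite wmap_gen ext_gen; congr (_ *: _); apply: eq_wtens => j le_jm.
  have lt_tm := ltn_ord t; rewrite /face_word /close_word /word_upd /=.
  have -> : (m.+1 < t)%N = false by lia.
  have -> : (m.+1 == t)%N = false by lia.
  by case: j {le_jm} => [|j] //; case: (nat_of_ord t) => [|t'] //=; rewrite mulrA.
rewrite (linearZ_LR (wmap _)) (linearZ_LR (ext _)) wmap_gen ext_gen; congr (_ *: _).
apply: eq_wtens => j le_jm;
  rewrite /face_word /close_word /word_upd /= ltnn eqxx ltnS le_jm.
by case: j {le_jm} => [|j] //; rewrite mulrA.
Qed.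

Lemma multilinear_close (V : lmodType k) m (h : word -> V) :
  (forall a b, (forall j, (j <= m)%N -> a j = b j) -> h a = h b) ->
  multilinear m h -> multilinear m.+1 (h \o close_word m.+1).
Proof.
move=> h_loc h_lin a l c x y le_lm /=.
have [-> | l_neq0] := eqVneq l 0%N.
  have E z : close_word m.+1 (word_upd a 0 z) = word_upd a 0 (a m.+1 * z).
    by apply/funext => -[|j].
  by rewrite !E mulrDr mulrA -in_pzalgC -mulrA h_lin.
have [-> | l_neq_m] := eqVneq l m.+1.
  have E z : h (close_word m.+1 (word_upd a m.+1 z)) = h (word_upd a 0 (z * a 0%N)).
    apply: h_loc => j le_jm; rewrite /close_word /word_upd eqxx /=.
    by case: j le_jm => // j le_jm; rewrite /= eqSS ltn_eqF.
  by rewrite !E mulrDl -mulrA h_lin.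
have E z : close_word m.+1 (word_upd a l z) = word_upd (close_word m.+1 a) l z.
  apply/funext => j; rewrite /close_word /word_upd [_ == l]eq_sym (negbTE l_neq_m).
  rewrite [0%N == l]eq_sym (negbTE l_neq0).
  by case: (j =P 0%N) => [->|//]; rewrite eq_sym (negbTE l_neq0).
by rewrite !E h_lin //; lia.
Qed.

Lemma eq_linear_wtens (V : lmodType k) m (F G : {linear tpow A m.+1 -> V}) :
  (forall a, F (wtens m a) = G (wtens m a)) -> F =1 G.
Proof.
move=> eqFG t; rewrite -[t]quot_mod_reprK.
pose q : {linear free_mod k {ffun 'I_m.+1 -> A} -> tpow A m.+1} :=
  to_quot_mod (@multilinear_rel k A m.+1).
apply: (eq_comp_gen (G := q) (G' := q)) => b.
by rewrite (wtens_inord b : q (gen k b) = _).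
Qed.

Lemma tpow_lift (V : lmodType k) m (h : word -> V) :
  (forall a b, (forall j, (j <= m)%N -> a j = b j) -> h a = h b) ->
  multilinear m h ->
  exists F : {linear tpow A m.+1 -> V}, forall a, F (wtens m a) = h a.
Proof.
move=> h_loc h_lin; pose h0 (b : {ffun 'I_m.+1 -> A}) := h (fun j => b (inord j)).
have h0_upd (b : {ffun 'I_m.+1 -> A}) i x :
    h0 (upd b i x) = h (word_upd (fun j => b (inord j)) i x).
  apply: h_loc => j le_jm; rewrite /upd ffunE /word_upd -val_eqE /= inordK //.
pose F (t : tpow A m.+1) : V := lin_ext h0 (quot_mod_repr t).
have F_pi w : F (to_quot_mod _ w) = lin_ext h0 w.
  have /span_ofP[s rel_s eq_s] :
      w - quot_mod_repr (to_quot_mod (@multilinear_rel k A m.+1) w)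
        \in span_of (@multilinear_rel k A m.+1).
    by apply/to_quot_mod_eq; rewrite quot_mod_reprK.
  apply/eqP; rewrite eq_sym -subr_eq0 /F -linearB eq_s linear_sum big_seq.
  apply/eqP/big1 => cu /rel_s[a [i [c [x [y ->]]]]].
  rewrite linearZ linearB linearP /= !lin_ext1 !h0_upd h_lin ?subrr ?scaler0 //.
  by rewrite -ltnS.
have F_lin : linear F.
  move=> c t u; rewrite -[t]quot_mod_reprK -[u]quot_mod_reprK.
  by rewrite -linearP !F_pi linearP.
pose mF := GRing.isLinear.Build k (tpow A m.+1) V *:%R F F_lin.
pose F' : {linear tpow A m.+1 -> V} := HB.pack F mF.
exists F' => a; rewrite /= /wtens /tens F_pi lin_ext1; apply: h_loc => j le_jm.
by rewrite ffunE inordK.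
Qed.

Lemma HH_neq0 (V : lmodType k) m (z : tpow A m.+2) (F : {linear tpow A m.+2 -> V}) :
  hoch_bd z = 0 -> (forall a, F (hoch_bd (wtens m.+2 a)) = 0) -> F z <> 0 ->
  exists x : HH A m.+1, x != 0.
Proof.
move=> z_cycle F_cocycle Fz.
have z_in : z \in @hoch_cycle k A m.+1 by rewrite hoch_cycleS z_cycle eqxx.
exists (to_quot_mod _ (exist _ z z_in : cycles A m.+1)).
apply/eqP => /eqP; rewrite -(linear0 (to_quot_mod _)) => /eqP/to_quot_mod_eq.
rewrite subr0 => /span_ofP[s bd_s /(congr1 val) eq_z]; apply: Fz.
have F_bd w : F (hoch_bd w) = 0.
  pose G : {linear tpow A m.+3 -> V} := F \o @hoch_bd k A m.+1.
  exact: (@eq_linear_wtens _ _ G \0 F_cocycle w).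
rewrite [z]eq_z raddf_sum raddf_sum /= big_seq big1 // => cu /bd_s[w bd_w].
by rewrite linearZ -bd_w /= F_bd scaler0.
Qed.

Variables (g : {poly k}) (X : A).
Hypothesis gX0 : peval X g = 0.

Definition odd_cycle i : tpow A i.*2.+2 :=
  ext (wtens i.*2.+1) (wmap (close_word i.*2.+2) (wmap cons1 (odd_core g X i))).

(** After closing, the two end multiplications by X agree, so [comm] becomes zero
    and the chain is a cycle. *)
Lemma hoch_bd_odd_cycle i : hoch_bd (odd_cycle i) = 0.
Proof.
rewrite /odd_cycle hoch_bd_close bar_cons1 !linearB /=.
have [_ /null_cons1 bar0] := bar_core gX0 i.
rewrite [X in _ - X]ext_wmap bar0 ?subr0; last first.
  apply: multilinear_close; last exact: multilinear_wtens.
  by move=> a b; apply: eq_wtens.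
rewrite /odd_core commE !linearB /= !ext_wmap; apply/eqP; rewrite subr_eq0;
  apply/eqP.
congr (ext _ _); apply/funext => a /=; apply: eq_wtens => j le_j.
rewrite /close_word /mul_first /mul_at /word_upd eqxx /=.
by case: j le_j => [|j] //= le_j; rewrite ?mulrA // eqSS ltn_eqF.
Qed.

End HochschildWords.

(** * The cocycles detecting the odd homology *)

Lemma big_ord_split3 (R : comPzRingType) (F H P : nat -> R) i s : (s < i)%N ->
  (forall j, (j < s)%N -> P j = F j) -> (forall j, (s < j)%N -> P j = H j) ->
  \prod_(j < i) P j = (\prod_(j < s) F j) * P s * \prod_(s.+1 <= j < i) H j.
Proof.
move=> lt_si PF PH; rewrite -!(big_mkord xpredT).
rewrite (big_cat_nat (leq0n s) (ltnW lt_si)) /= (big_ltn lt_si) mulrA.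
congr (_ * _ * _); apply: eq_big_nat => j /andP[le_j lt_j]; [exact: PF|exact: PH].
Qed.

Lemma alternating_pairs (V : zmodType) (F : nat -> V) n :
  \sum_(t < n.*2) F t = \sum_(s < n) (F s.*2 + F s.*2.+1).
Proof.
by elim: n => [|n IHn]; rewrite ?big_ord0 // doubleS !big_ord_recr /= IHn addrA.
Qed.

(** In this section k[x]/(g) is a retract of A: the morphism [pi] goes down, and X
    is a root of g in A that it sends to the class of x. The polynomial d is a
    nonconstant common divisor of g and its derivative. *)
Section Retraction.
Variables (k : fieldType) (A : pzAlgType k) (g d : {poly k}) (X : A).
Variable pi : {rmorphism A -> quot_alg (fun _ : 'I_1 => g)}.
Hypotheses (pi_alg : is_alg_morphism pi) (piX : pi X = to_quot _ 'X).
Hypotheses (g_neq0 : g != 0) (dvd_g : d %| g) (dvd_g' : d %| g^`()).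
Hypothesis (d_neq1 : ~~ (d %| 1)).
Local Notation word := (word A).
Local Notation W := (free_mod k word).
Implicit Types (a b c x y : A) (w : word) (p q : {poly k}).

Definition rep a : {poly k} := projT1 (cid (to_quot_surj (pi a))) %% g.

Lemma repE p a : pi a = to_quot _ p -> rep a = p %% g.
Proof.
rewrite /rep; case: cid => q /= -> /to_quot_eq/idealP[s eq_qp].
rewrite -[q in LHS](subrK p) modpD.
suff -> : (q - p) %% g = 0 by rewrite add0r.
apply/eqP; rewrite eq_qp -/(dvdp _ _);
  apply: (big_ind (fun u => g %| u)) => [|u v gu gv|t _].
- exact: dvdp0.
- exact: dvdp_add.
by rewrite dvdp_mulr // dvdp_mull.
Qed.

Lemma pi_rep a : pi a = to_quot _ (rep a).
Proof.
have [p pip] := to_quot_surj (pi a); rewrite (repE pip) pip.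
rewrite {1}(divp_eq p g) rmorphD rmorphM /= quot_poly_gen0 mulr0 add0r //.
Qed.

Lemma modp_rep a : rep a %% g = rep a.
Proof. by rewrite /rep modp_small // ltn_modp. Qed.

(** A nonzero polynomial of degree at most one is prime to its derivative. *)
Lemma size_g : (2 < size g)%N.
Proof.
rewrite ltnNge; apply: contra d_neq1 => le_g2.
have g'E : g^`() = (g`_1)%:P.
  rewrite [LHS]size1_polyC ?coef_deriv ?mulr1n //.
  by rewrite (leq_trans (size_poly _ _)) //; case: (size g) le_g2 => [|[|[]]].
have [g1_0 | g1_neq0] := eqVneq g`_1 0.
  have gE : g = (g`_0)%:P.
    apply: size1_polyC; rewrite leqNgt; apply/negP => lt1.
    have eq_g2 : size g = 2%N by apply/eqP; rewrite eqn_leq le_g2.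
    by move: g_neq0; rewrite -lead_coef_eq0 lead_coefE eq_g2 g1_0 eqxx.
  have g0 : g`_0 != 0 by rewrite -polyC_eq0 -gE.
  by move: dvd_g; rewrite gE -[_%:P]mulr1 mul_polyC dvdpZr.
by move: dvd_g'; rewrite g'E -[_%:P]mulr1 mul_polyC dvdpZr.
Qed.

Lemma repX : rep X = 'X.
Proof. by rewrite (repE piX) modp_small // size_polyX size_g. Qed.

Lemma rep1 : rep 1 = 1.
Proof.
by rewrite (@repE 1) ?rmorph1 // modp_small // size_poly1 ltnW ?size_g.
Qed.

Lemma repP (c : k) x y : rep (in_pzalg c * x + y) = c *: rep x + rep y.
Proof.
rewrite (@repE (c%:P * rep x + rep y)).
  by rewrite mul_polyC modpD modpZl !modp_rep.
by rewrite !rmorphD !rmorphM /= -!pi_rep pi_alg.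
Qed.

(** The class of the square zero extension k[x]/(g^2) of k[x]/(g): a Hochschild
    2-cocycle with values in k[x]/(g). *)
Definition carry a b : {poly k} := (rep a * rep b) %/ g.

Lemma rep_mul a b : rep (a * b) = rep a * rep b - carry a b * g.
Proof.
rewrite (@repE (rep a * rep b)); last by rewrite !rmorphM /= -!pi_rep.
by rewrite {2}(divp_eq (rep a * rep b) g) addrC addKr.
Qed.

Lemma carry_mul_g a b : carry a b * g = rep a * rep b - rep (a * b).
Proof. by rewrite rep_mul opprB addrC subrK. Qed.

Lemma carryP_l (c : k) x y b : carry (in_pzalg c * x + y) b =
  c *: carry x b + carry y b.
Proof. by rewrite /carry repP mulrDl -scalerAl divpD divpZl. Qed.

Lemma carryP_r (c : k) x y b : carry b (in_pzalg c * x + y) =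
  c *: carry b x + carry b y.
Proof. by rewrite /carry repP mulrDr -scalerAr divpD divpZl. Qed.

Lemma carry1 a : carry a 1 = 0.
Proof. by rewrite /carry rep1 mulr1 divp_small // /rep ltn_modp. Qed.

(** Multiplied by g, this is the associativity of the product of A. *)
Lemma carry_cocycle a b c :
  carry (a * b) c - carry a (b * c) = rep a * carry b c - carry a b * rep c.
Proof.
apply: (mulIf g_neq0); rewrite !mulrBl -!mulrA [rep c * g]mulrC !mulrA.
rewrite -(mulrA (rep a)) !carry_mul_g mulrA; ring.
Qed.

(** The cup product of the derivation d/dx, well defined modulo d, with i copies
    of the 2-cocycle [carry]. *)
Definition cochain i w : {poly k} := rep (w 0%N) * (rep (w 1%N))^`()
  * \prod_(j < i) carry (w j.+1.*2) (w j.+1.*2.+1).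

Lemma eq_cochain i w w' : (forall j, (j <= i.*2.+1)%N -> w j = w' j) ->
  cochain i w = cochain i w'.
Proof.
move=> eq_w; rewrite /cochain !eq_w //; congr (_ * _); apply: eq_bigr => j _.
by have lt_ji := ltn_ord j; rewrite !eq_w //; lia.
Qed.

Lemma cochainS i w : cochain i.+1 w =
  cochain i w * carry (w i.+1.*2) (w i.+1.*2.+1).
Proof. by rewrite /cochain big_ord_recr mulrA. Qed.

Lemma multilinear_cochain i : multilinear i.*2.+1 (cochain i).
Proof.
elim: i => [|i IHi] w l c x y le_l.
  rewrite /cochain !big_ord0 !mulr1; case: l le_l => [|[|//]] _;
    rewrite /word_upd /=.
    by rewrite repP mulrDl -scalerAl.
  by rewrite repP derivD derivZ mulrDr -scalerAr.
have cochain_top z : (i.*2.+1 < l)%N -> cochain i (word_upd w l z) = cochain i w.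
  by move=> lt_l; apply: eq_cochain => j le_j; rewrite /word_upd ltn_eqF //; lia.
rewrite !cochainS; have [lt_l | ge_l] := leqP l i.*2.+1.
  rewrite IHi // /word_upd !gtn_eqF ?doubleS ?ltnS // ?(leqW lt_l) //.
  by rewrite mulrDl -scalerAl.
rewrite !cochain_top //; have [-> | ne_l] := eqVneq l i.+1.*2.
  by rewrite /word_upd eqxx gtn_eqF // carryP_l mulrDr -scalerAr.
have -> : l = i.+1.*2.+1 by lia.
by rewrite /word_upd eqxx ltn_eqF // carryP_r mulrDr -scalerAr.
Qed.

(** The value left over by the faces 2s+2 and following when the cocycle identity
    is applied: the entry 2s+2 stands alone between the first s and the last i-s
    pairs. *)
Definition cochain_mid i w s : {poly k} := rep (w 0%N) * (rep (w 1%N))^`()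
  * (\prod_(j < s) carry (w j.+1.*2) (w j.+1.*2.+1)) * rep (w s.+1.*2)
  * \prod_(s <= j < i) carry (w j.+1.*2.+1) (w j.+2.*2).

Lemma cochain_face_pair i w s : (s < i)%N ->
  cochain i (face_word s.+1.*2 w) - cochain i (face_word s.+1.*2.+1 w)
    = cochain_mid i w s - cochain_mid i w s.+1.
Proof.
move=> lt_si.
pose F j := carry (w j.+1.*2) (w j.+1.*2.+1).
pose H j := carry (w j.+1.*2.+1) (w j.+2.*2).
pose G t j := carry (face_word t w j.+1.*2) (face_word t w j.+1.*2.+1).
have lo t j : (j.+1.*2.+1 < t)%N -> G t j = F j.
  by move=> lt_jt; rewrite /G !face_word_lt // ltnW.
have hi t j : (t < j.+1.*2)%N -> G t j = H j.
  by move=> lt_tj; rewrite /G !face_word_gt // leqW.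
rewrite /cochain (big_ord_split3 (F := F) (H := H) (P := G s.+1.*2) lt_si);
  first last.
- by move=> j lt_sj; apply: hi; lia.
- by move=> j lt_sj; apply: lo; lia.
rewrite (big_ord_split3 (F := F) (H := H) (P := G s.+1.*2.+1) lt_si); first last.
- by move=> j lt_sj; apply: hi; lia.
- by move=> j lt_sj; apply: lo; lia.
rewrite /cochain_mid (big_ltn lt_si) big_ord_recr /= -/(F s) -/(H s).
have -> : G s.+1.*2 s = carry (w s.+1.*2 * w s.+1.*2.+1) (w s.+2.*2).
  by rewrite /G face_word_eq face_word_gt.
have -> : G s.+1.*2.+1 s = carry (w s.+1.*2) (w s.+1.*2.+1 * w s.+2.*2).
  by rewrite /G face_word_eq face_word_lt.
rewrite /face_word /=; set P := \prod_(j < s) _; set Q := \prod_(_ <= j < _) _.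
transitivity (rep (w 0%N) * (rep (w 1%N))^`() * P * Q *
  (carry (w s.+1.*2 * w s.+1.*2.+1) (w s.+2.*2) -
   carry (w s.+1.*2) (w s.+1.*2.+1 * w s.+2.*2))); first by ring.
by rewrite carry_cocycle /F /H; ring.
Qed.

(** The Leibniz rule: it holds up to multiples of g and of its derivative. *)
Lemma cochain_face01 i w :
  d %| cochain i (face_word 0 w) - cochain i (face_word 1 w) + cochain_mid i w 0.
Proof.
rewrite /cochain /cochain_mid big_ord0 big_mkord /face_word /=.
set Q := \prod_(j < i) carry (w j.*2.+3) _.
rewrite !rep_mul derivB !derivM -[1.*2]/2%N.
rewrite [X in _ %| X](_ : _ = Q * (rep (w 0%N) * (carry (w 1%N) (w 2))^`()
   - carry (w 0%N) (w 1%N) * (rep (w 2))^`()) * g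
   + Q * rep (w 0%N) * carry (w 1%N) (w 2) * g^`()); last by ring.
by rewrite dvdp_add ?dvdp_mull.
Qed.

Lemma cochain_close i w :
  d %| cochain i (close_word i.*2.+2 w) - cochain_mid i w i.
Proof.
rewrite /cochain /cochain_mid big_geq // mulr1 /close_word /word_upd /= rep_mul
  doubleS.
set P := \prod_(j < i) _.
rewrite [X in _ %| X](_ : _ =
  - (carry (w i.*2.+2) (w 0%N) * (rep (w 1%N))^`() * P) * g).
  by rewrite dvdp_mull.
by ring.
Qed.

(** The faces are grouped in pairs; the first pair is the Leibniz rule, the others
    telescope by the cocycle identity, and the cyclic face cancels the end. *)
Lemma cochain_boundary i w :
  d %| \sum_(t < i.*2.+2) (-1) ^+ t *: cochain i (face_word t w)
       + (-1) ^+ i.*2.+2 *: cochain i (close_word i.*2.+2 w).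
Proof.
rewrite -doubleS (alternating_pairs (fun t =>
  (-1) ^+ t *: cochain i (face_word t w))).
rewrite (eq_bigr (fun s : 'I_i.+1 =>
  cochain i (face_word s.*2 w) - cochain i (face_word s.*2.+1 w)));
  last first.
  move=> s _; rewrite exprS -[(-1) ^+ s.*2]signr_odd odd_double.
  by rewrite mulr1 scaleN1r scale1r.
rewrite -[(-1) ^+ i.+1.*2]signr_odd odd_double scale1r big_ord_recl.
rewrite (eq_bigr (fun s : 'I_i => - (cochain_mid i w s.+1 - cochain_mid i w s)));
  last first.
  by move=> s _; rewrite opprB -cochain_face_pair.
rewrite sumrN -(big_mkord xpredT (fun s =>
  cochain_mid i w s.+1 - cochain_mid i w s)).
rewrite telescope_sumr //= opprB -[0.*2]/0%N.
rewrite [X in _ %| X](_ : _ =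
    (cochain i (face_word 0 w) - cochain i (face_word 1 w) + cochain_mid i w 0)
    + (cochain i (close_word i.*2.+2 w) - cochain_mid i w i)); last by ring.
by rewrite dvdp_add ?cochain_face01 ?cochain_close.
Qed.

Lemma rep_exp n : rep (X ^+ n) = 'X^n %% g.
Proof. by apply: repE; rewrite !rmorphXn /= piX. Qed.

(** The sum telescopes, because g times [carry] measures how far [rep] is from
    being multiplicative. *)
Lemma carry_powers n :
  (\sum_(j < n) 'X^(n.-1 - j) * carry (X ^+ j) X) * g = 'X^n - 'X^n %% g.
Proof.
pose Q j := - ('X^(n - j) * rep (X ^+ j)).
transitivity (\sum_(0 <= j < n) (Q j.+1 - Q j)); last first.
  rewrite telescope_sumr // /Q subnn subn0 !expr0 mul1r rep1 mulr1 rep_exp.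
  by rewrite opprK addrC.
rewrite big_mkord mulr_suml; apply: eq_bigr => j _.
rewrite -mulrA carry_mul_g repX -exprSr /Q.
have -> : (n - j.+1 = n.-1 - j)%N by lia.
have -> : (n - j = (n.-1 - j).+1)%N by have := ltn_ord j; lia.
by rewrite (exprSr 'X); ring.
Qed.

(** The 2-cocycle evaluates to 1 on the degree 2 generator of the periodic
    resolution, in every characteristic. *)
Lemma carry_diff_quot :
  \sum_(n < size g) g`_n *: \sum_(j < n) 'X^(n.-1 - j) * carry (X ^+ j) X = 1.
Proof.
apply: (mulIf g_neq0); rewrite mul1r mulr_suml.
rewrite (eq_bigr (fun n : 'I__ => g`_n *: 'X^n - (g`_n *: 'X^n) %% g)); last first.
  by move=> n _; rewrite -scalerAl carry_powers scalerBr modpZl.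
rewrite sumrB -(big_morph (fun p => p %% g) (fun p q => modpD g p q) (mod0p g)).
by rewrite -poly_def coefK modpp subr0.
Qed.

(** What remains of [cochain i] on a closed word once the derivation has been
    evaluated on the factor X. *)
Definition bar_cochain i w : {poly k} :=
  rep (w i.*2) * \prod_(j < i) carry (w j.*2) (w j.*2.+1).

(** The second half of [odd_core] has 1 in the slot of the derivation and does not
    contribute; the first half has X there. *)
Lemma cochain_odd_core i :
  ext (cochain i \o close_word i.*2.+2) (wmap cons1 (odd_core g X i))
    = ext (bar_cochain i) (even_core g X i).
Proof.
rewrite ext_wmap /odd_core commE linearB /= !ext_wmap.
rewrite [in X in _ - X](_ : _ \o _ = fun=> 0); last first.
  apply/funext => w /=; rewrite /cochain /close_word /mul_at /word_upd /=.
  by rewrite rep1 derivC mulr0 mul0r.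
rewrite (_ : ext (fun=> 0) _ = 0) ?subr0; last first.
  by elim/free_ind: (even_core _ _ _) => [|c w u IHu];
    rewrite ?linear0 // linearP IHu ext_gen scaler0 addr0.
congr (ext _ _); apply/funext => w /=.
by rewrite /cochain /bar_cochain /close_word /mul_first /word_upd /= !mulr1 repX
  derivX mulr1.
Qed.

Lemma dvdp_linear (F F' : {linear W -> {poly k}}) :
  (forall w, d %| F (gen k w) - F' (gen k w)) -> forall u, d %| F u - F' u.
Proof.
move=> dvd_F; elim/free_ind => [|c w u IHu];
  first by rewrite (linear0 F) (linear0 F') subr0 dvdp0.
rewrite (linearP F) (linearP F') opprD addrACA -scalerBr.
by rewrite dvdp_add // -mul_polyC dvdp_mull.
Qed.

Lemma bar_cochain_step i w n j :
  bar_cochain i.+1 (mul_first (X ^+ j) (mul_at i.*2.+2 (X ^+ n)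
    (cons1 (mul_first X (cons1 w)))))
  = rep (w i.*2 * X ^+ n)
    * (carry (X ^+ j) X * \prod_(l < i) carry (w l.*2) (w l.*2.+1)).
Proof.
rewrite /bar_cochain big_ord_recl /mul_first /mul_at /word_upd /= eqxx !mulr1;
  congr (_ * (_ * _)).
apply: eq_bigr => l _; have := ltn_ord l;
  rewrite /bump /= add1n doubleS /= => lt_li.
by rewrite !ltn_eqF //; lia.
Qed.

(** The cocycle [carry] is normalized. *)
Lemma bar_cochain_step0 i w n j :
  bar_cochain i.+1 (mul_first (X ^+ j) (mul_at i.*2.+2 (X ^+ n)
    (cons1 (mul_at i.*2.+1 X (cons1 w))))) = 0.
Proof.
by rewrite /bar_cochain big_ord_recl /mul_first /mul_at /word_upd /= carry1 mul0r
  mulr0.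
Qed.

Lemma dvd_rep_mulX a n : d %| rep (a * X ^+ n) - rep a * 'X^n.
Proof.
apply: dvdp_trans dvd_g _; rewrite rep_mul rep_exp {2}(divp_eq 'X^n g).
rewrite [X in _ %| X](_ : _ =
  - (carry a (X ^+ n) + rep a * ('X^n %/ g)) * g) ?dvdp_mull //.
by ring.
Qed.

Lemma bar_cochain_diff_quot i w :
  ext (bar_cochain i.+1) (diff_quot g X i.*2.+2 (wmap cons1
    (comm X i.*2.+1 (wmap cons1 (gen k w)))))
  = \sum_(n < size g) g`_n *: \sum_(j < n) rep (w i.*2 * X ^+ (n.-1 - j))
      * (carry (X ^+ j) X * \prod_(l < i) carry (w l.*2) (w l.*2.+1)).
Proof.
rewrite wmap_gen ext_gen linearB /= !wmap_gen diff_quotE (linear_sum (ext _)).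
apply: eq_bigr => n _; rewrite (linearZ_LR (ext _)) (linear_sum (ext _)).
congr (_ *: _); apply: eq_bigr => j _; rewrite !ext_wmap linearB /= !ext_gen /=.
by rewrite bar_cochain_step bar_cochain_step0 subr0.
Qed.

(** One more step of the periodic resolution brings in one more factor [carry],
    evaluated on the degree 2 generator, where it is 1. *)
Lemma bar_cochain_core i : d %| ext (bar_cochain i) (even_core g X i) - 1.
Proof.
elim: i => [|i IHi].
  by rewrite /= ext_gen /bar_cochain big_ord0 mulr1 rep1 subrr dvdp0.
rewrite -(subrK (ext (bar_cochain i) (even_core g X i))
  (ext (bar_cochain i.+1) _)) -addrA.
apply: dvdp_add IHi.
pose F : {linear W -> {poly k}} := ext (bar_cochain i.+1) \o
  (diff_quot g X i.*2.+2 \o (wmap cons1 \o (comm X i.*2.+1 \o wmap cons1))).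
apply: (dvdp_linear (F := F)) => w; rewrite /F /= bar_cochain_diff_quot ext_gen.
rewrite -[bar_cochain i w]mulr1 -[in X in _ - X]carry_diff_quot mulr_sumr -sumrB.
apply: (big_ind (fun p => d %| p)) => [|p q dp dq|n _];
  [exact: dvdp0|exact: dvdp_add|].
rewrite -scalerAr -scalerBr -mul_polyC dvdp_mull // mulr_sumr -sumrB.
apply: (big_ind (fun p => d %| p)) => [|p q dp dq|j _];
  [exact: dvdp0|exact: dvdp_add|].
rewrite /bar_cochain; set P := \prod_(l < i) _; set c := carry _ _.
rewrite [X in _ %| X](_ : _ =
  c * P * (rep (w i.*2 * X ^+ (n.-1 - j)) - rep (w i.*2) * 'X^(n.-1 - j))).
  by rewrite dvdp_mull // dvd_rep_mulX.
by ring.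
Qed.

Hypothesis gX0 : peval X g = 0.

(** The cycle [odd_cycle i] pairs to 1 modulo d with [cochain i]. *)
Lemma HH_odd_neq0 i : exists z : HH A i.*2.+1, z != 0.
Proof.
pose h w := cochain i w %% d.
have h_loc w w' : (forall j, (j <= i.*2.+1)%N -> w j = w' j) -> h w = h w'.
  by move=> eq_w; rewrite /h (eq_cochain eq_w).
have h_lin : multilinear i.*2.+1 h.
  by move=> w l c x y le_l; rewrite /h multilinear_cochain // modpD modpZl.
have [F FE] := tpow_lift h_loc h_lin.
apply: (HH_neq0 (F := F) (hoch_bd_odd_cycle gX0 i)) => [w|F0].
  rewrite hoch_bd_wtens linearD linearZ /= linear_sum FE /h.
  rewrite (eq_bigr (fun t : 'I__ => ((-1) ^+ t *: cochain i (face_word t w)) %% d)).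
    rewrite -(big_morph (fun p => p %% d) (fun p q => modpD d p q) (mod0p d)).
    by rewrite -modpZl -modpD; apply/eqP/cochain_boundary.
  by move=> t _; rewrite linearZ /= FE modpZl.
suff : d %| F (odd_cycle g X i) - 1 by rewrite F0 sub0r dvdpNr (negbTE d_neq1).
rewrite -(subrK (ext (bar_cochain i) (even_core g X i)) (F _)) -addrA.
rewrite dvdp_add ?bar_cochain_core // -cochain_odd_core.
rewrite /odd_cycle ext_comp ext_wmap.
apply: dvdp_linear => w; rewrite !ext_gen /= FE /h.
rewrite {2}(divp_eq (cochain _ _) d) opprD addrCA subrr addr0.
by rewrite -mulNr dvdp_mull.
Qed.

End Retraction.

(** * The retraction of A onto k[x]/(g) *)

Section FreeEvaluation.
Variables (k : fieldType) (I : choiceType) (v : I -> {poly k}).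

Definition fmonom_prod (m : {fmonom I}) : {poly k} := \prod_(i <- m) v i.

Fact fmonom_prod_mmorphism : mmorphism fmonom_prod.
Proof.
by split=> [m1 m2|]; rewrite /fmonom_prod ?fmM ?big_cat // fm1 big_nil.
Qed.
HB.instance Definition _ :=
  monalg.isMultiplicative.Build _ _ fmonom_prod fmonom_prod_mmorphism.

Definition free_eval : {malg k[{fmonom I}]} -> {poly k} :=
  mmap (@polyC k) fmonom_prod.
HB.instance Definition _ := GRing.RMorphism.on free_eval.

Lemma free_evalU i : free_eval << fmu i >> = v i.
Proof. by rewrite [LHS]mmapU mul1r /fmonom_prod fmU big_seq1. Qed.

Lemma free_evalZ c u : free_eval (c *: u) = c *: free_eval u.
Proof. by rewrite [LHS]mmapZ mul_polyC. Qed.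

Lemma free_evalC c : free_eval c%:MP = c%:P.
Proof. exact: mmapC. Qed.

End FreeEvaluation.

Theorem theoremI (k : fieldType) (n p : nat)
    (f : 'I_p.+1 -> free_alg k n.+1) (g : {poly k})
    (f_first : f ord0 = \sum_(i < size g) g`_i *: fvar ord0 ^+ i)
    (f_others : forall i : 'I_p,
      f (lift ord0 i) \in ideal (fun j : 'I_n => @fvar k n.+1 (lift ord0 j)))
    (B_not_smooth : ~ smooth (quot_alg (fun _ : 'I_1 => g))) :
  exists m : nat -> nat,
    (forall j : nat, (m j < m j.+1)%N) /\
    (forall j : nat, exists z : HH (quot_alg f) (m j), z != 0).
Proof.
have g_neq0 : g != 0.
  by apply/eqP => g0; apply/B_not_smooth/smooth_quot_poly; left.
have d_neq1 : ~~ (gcdp g g^`() %| 1).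
  apply/negP; rewrite dvdp1 => cop.
  by apply/B_not_smooth/smooth_quot_poly; right.
exists (fun j => j.*2.+1); split=> j; first by rewrite doubleS ltnS ltnW.
pose ev : {rmorphism free_alg k n.+1 -> {poly k}} :=
  free_eval (fun i : 'I_n.+1 => if i == ord0 then 'X else 0 : {poly k}).
have evU i : ev (fvar i) = if i == ord0 then 'X else 0 by exact: free_evalU.
have ev_gen i : to_quot (fun _ : 'I_1 => g) (ev (f i)) = 0.
  case: (unliftP ord0 i) => [l ->|->].
    suff -> : ev (f (lift ord0 l)) = 0 by rewrite raddf0.
    by apply: ideal_ker (f_others l) => q; rewrite evU.
  have -> : ev (f ord0) = g; last exact: quot_poly_gen0.
  rewrite f_first (rmorph_sum ev) -[RHS]coefK poly_def.
  by apply: eq_bigr => l _; rewrite [LHS]free_evalZ (rmorphXn ev) evU.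
have [pi piE] := quot_lift (phi := to_quot (fun _ : 'I_1 => g) \o ev) ev_gen.
apply: (@HH_odd_neq0 _ _ g (gcdp g g^`()) (to_quot f (fvar ord0)) pi) => //.
- by move=> c; rewrite [in_pzalg c]/(to_quot f c%:MP) piE /= /ev free_evalC.
- by rewrite piE /= evU.
- exact: dvdp_gcdl.
- exact: dvdp_gcdr.
rewrite -(raddf0 (to_quot f)); transitivity (to_quot f (f ord0)); last first.
  by apply/to_quot_eq; rewrite subr0; apply: ideal_gen.
rewrite f_first rmorph_sum; apply: eq_bigr => i _.
by rewrite -mul_malgC rmorphM rmorphXn.
Qed.
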